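(* Let $K$ be a finite extension of $\mathbb{Q}$ and let $\mathcal{O}_{K}$ be its ring of integers. For a nonzero ideal $\mathcal{I}\subseteq \mathcal{O}_K$ let $N(\mathcal{I})=\left|\mathcal{O}_K/\mathcal{I}\right|$. Define $$\zeta_{\mathcal{O}_K}(s)=\sum_{0\neq \mathcal{I}\subseteq \mathcal{O}_K}\frac{1}{N(\mathcal{I})^s},\qquad \zeta_{\mathcal{O}^2_K}(s)=\sum_{\substack{M\subseteq \mathcal{O}^2_K\\ \mathcal{O}^2_K/M\text{ torsion}}}\frac{1}{\left|\mathcal{O}^2_K/M\right|^s},\qquad \zeta^{\mathcal{O}_K}_{\mathbb{PF}^1}(s)=\sum_{0\neq \mathcal{I}\subseteq \mathcal{O}_K}\frac{|\mathbb{PF}^1_{\mathcal{I}}|}{N(\mathcal{I})^s},$$ where the first and third sums run over all nonzero ideals $\mathcal{I}$ of $\mathcal{O}_K$ and the second over all $\mathcal{O}_K$-submodules $M$ of $\mathcal{O}_K^2$ with torsion quotient $\mathcal{O}_K^2/M$. Then for $s\in \mathbb{C}$ with $\operatorname{Re}(s)>2$: \begin{enumerate} \item $\zeta_{\mathcal{O}^2_K}(s)=\zeta_{\mathcal{O}_K}(s-1)\,\zeta_{\mathcal{O}_K}(s)$. \item $\zeta_{\mathcal{O}^2_K}(s)=\zeta_{\mathcal{O}_K}(2s)\,\zeta^{\mathcal{O}_K}_{\mathbb{PF}^1}(s)$. \end{enumerate}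
   Context: Projective space associated to an ideal: for a Dedekind domain $\mathcal{O}$ let $(\mathcal{O}^2)^{*}=\{(a,b)\in \mathcal{O}^2\mid \langle a\rangle +\langle b\rangle = \mathcal{O}\}$. For an ideal $\mathcal{I}\subseteq\mathcal{O}$, define the equivalence relation on $(\mathcal{O}^2)^*$ by $(a,b)\sim (c,d)$ iff $ad-bc\in \mathcal{I}$. Then $\mathbb{PF}^1_{\mathcal{I}}=(\mathcal{O}^2)^{*}/\sim$, and $|\mathbb{PF}^1_{\mathcal{I}}|$ denotes its cardinality (here with $\mathcal{O}=\mathcal{O}_K$). *)

(* Defs.v *)
From HB Require Import structures.
From mathcomp Require Import all_boot all_order all_algebra all_field.
From mathcomp Require Import finmap complex.
From mathcomp Require Import all_classical all_reals all_analysis.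

Set Implicit Arguments.
Unset Strict Implicit.
Unset Printing Implicit Defensive.

Import Order.TTheory GRing.Theory Num.Theory.
Import numFieldNormedType.Exports.

Local Open Scope classical_set_scope.
Local Open Scope ring_scope.
Local Open Scope complex_scope.

Section UnconditionalSum.
Variables (R : realType) (T : choiceType).
Implicit Types (D : set T) (f : T -> R[i]).

(* The finite subsets of D, directed by inclusion. *)
Definition fsets_filter D : set_system (set T) :=
  filter_from (fsets D) (fun A => [set B | fsets D B /\ A `<=` B]).

#[global] Instance fsets_filter_proper D : ProperFilter (fsets_filter D).
Proof.
apply: filter_from_proper; last by move=> A DA; exists A; split.
apply: filter_from_filter; first by exists set0; split; [exact: finite_set0 | exact: sub0set].
move=> A B [finA AD] [finB BD]; exists (A `|` B).
  by split; [rewrite finite_setU | rewrite subUset].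
by move=> C [CD]; rewrite subUset => -[AC BC].
Qed.

Definition partial_sum f (A : set T) : R[i]^o := \sum_(x \in A) f x.

Definition csummable D f : Prop := cvg (partial_sum f @ fsets_filter D).

Definition csum D f : R[i] := lim (partial_sum f @ fsets_filter D).

End UnconditionalSum.

Section ComplexPower.
Variable R : realType.

Definition cexp (z : R[i]) : R[i] :=
  (expR (complex.Re z))%:C * (cos (complex.Im z) +i* sin (complex.Im z)).

(* n ^ s = exp (s log n) for n > 0; at n = 0, ln 0 = 0 makes it 1. *)
Definition natcpow (n : nat) (s : R[i]) : R[i] := cexp (s * (ln n%:R)%:C).

End ComplexPower.

(* The classes of the relation E on D; it is the quotient D / E when E is an
   equivalence relation on D. *)
Definition quotient_set (T : Type) (D : set T) (E : T -> T -> Prop) :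
  set (set T) := [set [set y | D y /\ E x y] | x in D].

(* Number of elements of a finite set; 0 when A is infinite. *)
Definition set_card (T : choiceType) (A : set T) : nat :=
  (#|` fset_set A|)%fset.

Section Modules.
Variables (A : comNzRingType) (V : lmodType A).

Definition submodule (M : set V) : Prop := submod_closed (mem M).

(* |V / M| *)
Definition module_index (M : set V) : nat :=
  set_card (quotient_set setT (fun x y : V => M (x - y))).

(* V / M is a torsion module, for A an integral domain. *)
Definition torsion_quotient (M : set V) : Prop :=
  forall v : V, exists2 r : A, r != 0 & M (r *: v).

End Modules.

Section Zeta.
Variables (R : realType) (A : comNzRingType).

(* Ideals of A are the submodules of the regular module A^o. *)
Definition ideal (I : set A) : Prop := submodule (I : set A^o).

Definition nonzero_ideals : set (set A) := [set I | ideal I /\ I <> [set 0]].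

Definition ideal_norm (I : set A) : nat := module_index (I : set A^o).

Definition free2 : lmodType A := (A^o * A^o)%type.

Definition cotorsion_submodules : set (set free2) :=
  [set M | submodule M /\ torsion_quotient M].

Definition principal (a : A) : set A := [set r * a | r in setT].

(* (A^2)^*: the pairs (a, b) such that <a> + <b> = A. *)
Definition unimodular : set (A * A) :=
  [set v | [set x + y | x in principal v.1 & y in principal v.2] = setT].

Definition PF1 (I : set A) : set (set (A * A)) :=
  quotient_set unimodular (fun v w => I (v.1 * w.2 - v.2 * w.1)).

Definition zeta_ideal_term (s : R[i]) (I : set A) : R[i] :=
  1 / natcpow (ideal_norm I) s.

Definition zeta_O2_term (s : R[i]) (M : set free2) : R[i] :=
  1 / natcpow (module_index M) s.

Definition zeta_PF1_term (s : R[i]) (I : set A) : R[i] :=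
  (set_card (PF1 I))%:R / natcpow (ideal_norm I) s.

Definition zeta_ideal s := csum nonzero_ideals (zeta_ideal_term s).
Definition zeta_O2 s := csum cotorsion_submodules (zeta_O2_term s).
Definition zeta_PF1 s := csum nonzero_ideals (zeta_PF1_term s).

Definition zeta_ideal_cvg s := csummable nonzero_ideals (zeta_ideal_term s).
Definition zeta_O2_cvg s :=
  csummable cotorsion_submodules (zeta_O2_term s).
Definition zeta_PF1_cvg s := csummable nonzero_ideals (zeta_PF1_term s).

End Zeta.

Section RingOfIntegers.
Variable K : fieldExtType rat.

Definition is_integral : {pred K} :=
  fun x => `[< integralOver (intr : int -> K) x >].

Fact is_integral_subring_closed : subring_closed is_integral.
Proof.
split=> [|x y /asboolP ix /asboolP iy|x y /asboolP ix /asboolP iy].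
- by apply/asboolP; exact: integral1.
- by apply/asboolP; exact: integral_sub.
- by apply/asboolP; exact: integral_mul.
Qed.

HB.instance Definition _ :=
  GRing.isSubringClosed.Build K is_integral is_integral_subring_closed.

Record ring_of_integers : Type := RingOfIntegers {
  algint :> K;
  algint_integral : algint \in is_integral }.

HB.instance Definition _ := [isSub for algint].
HB.instance Definition _ := [Choice of ring_of_integers by <:].
HB.instance Definition _ :=
  [SubChoice_isSubComNzRing of ring_of_integers by <:].

End RingOfIntegers.

(* Main.v *)
(* Let A be the ring of integers of K.  A submodule M of A^2 with torsion
   quotient is given by its projection I to the second coordinate, the ideal
   J = {x | (x, 0) in M} and a homomorphism I -> A / J.  As I is invertible, it
   is generated by a single element a modulo I J, so that there are N(J) such
   homomorphisms, determined by the image of a, and |A^2 / M| = N(I) N(J).  This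
   gives zeta(s) zeta(s - 1).
     On the other hand M = I M' in a unique way, where I is the ideal generated by
   the coordinates of the elements of M and those of M' generate A; then
   |A^2 / M| = N(I)^2 |A^2 / M'|.  Such an M' contains a unimodular vector (a, b),
   hence M' = {(x, y) | a y - b x in J} for J the annihilator of A^2 / M', and the
   M' with annihilator J are the points of PF^1_J, all of index N(J).
     Prime avoidance is replaced by a computation with idempotents in the finite
   ring A / J.  The sums converge because there are at most [K : Q] maximal ideals
   with a given residue characteristic p, each of norm at least p, which bounds
   the Euler product. *)

Require Import Defs.
From mathcomp Require Import all_boot all_order all_algebra all_field finmap.
From mathcomp Require Import complex ring lra.
From mathcomp Require Import all_classical all_reals all_analysis.
Import Order.TTheory GRing.Theory Num.Theory.
Import numFieldNormedType.Exports.
Set Implicit Arguments.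
Unset Strict Implicit.
Unset Printing Implicit Defensive.
Local Open Scope classical_set_scope.
Local Open Scope ring_scope.

(** * Unconditional sums *)

(** [csum] is a [lim], meaningful only once convergence is known, and [set_card] is 0 on an infinite
    set. Hence the five convergences belong to the conclusion, and finiteness is proved along with
    every cardinality. Convergence always comes from bounds on the finite partial sums of absolute
    values. The arithmetic takes place over a commutative ring A with four properties: the regular
    module is torsion free, quotients by nonzero elements are finite, A is integrally closed in the
    form used by the determinant trick, and |A / m| <= m^d. Ideals and lattices are bare sets, so
    quotients are replaced by classifying maps and fractional ideals by clearing denominators. The
    obstacle is that ideals need not be principal and lattices need not have bases. Freeness is
    available only modulo a nonzero ideal, and one stable range argument in the finite quotient
    supplies it both for ideals (a generator modulo I J) and for lattices (a unimodular vector). The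
    threshold Re s > 2 is the one of the factor zeta(s - 1). *)

Lemma fsbig_fiber (V : nmodType) (T U : choiceType) (p : T -> U) (F : T -> V)
    (A : set T) (B : set U) : finite_set A -> finite_set B ->
  (forall x, A x -> B (p x)) ->
  \sum_(x \in A) F x = \sum_(u \in B) \sum_(x \in A `&` p @^-1` [set u]) F x.
Proof.
move=> finA finB AB.
under [RHS]eq_fsbigr => u _.
  rewrite fsbig_mkcondr; over.
rewrite exchange_fsbig //; apply: eq_fsbigr => x; rewrite inE => Ax.
rewrite (@fsbigD1 _ _ _ _ (p x)) //=; last exact: AB.
rewrite mem_set //= fsbig1 ?addr0 // => u [_ /= /eqP nu].
by rewrite memNset // => /= /eqP; rewrite eq_sym (negbTE nu).
Qed.

Section HasSum.
Variable R : realType.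

(** An epsilon form of convergence along [fsets_filter] that names the value, so that identities
    between sums follow from [has_csum_uniq] without computing a [lim]. *)
Definition has_csum (T : choiceType) (D : set T) (f : T -> R[i]) (l : R[i]) :=
  forall e : R[i], 0 < e -> exists2 A, fsets D A &
    forall B, fsets D B -> A `<=` B -> `|l - \sum_(x \in B) f x| < e.

(** The constant stays visible because the Euler product multiplies one such constant per maximal
    ideal. *)
Definition sum_le (T : choiceType) (D : set T) (g : T -> R) (C : R) :=
  forall A, fsets D A -> \sum_(x \in A) g x <= C.

Definition sum_bounded (T : choiceType) (D : set T) (g : T -> R) :=
  exists C : R, sum_le D g C.

Section FixedDomain.
Variables (T : choiceType) (D : set T).
Implicit Types f : T -> R[i].

Lemma has_csum_cvg f l : has_csum D f l ->
  partial_sum f @ fsets_filter D --> (l : R[i]^o).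
Proof.
move=> h; apply/cvgrPdist_lt => e e0; have [A DA hA] := h e e0.
by exists A => // B [DB AB]; exact: hA.
Qed.

Lemma has_csum_csum f l : has_csum D f l -> csummable D f /\ csum D f = l.
Proof.
move=> /has_csum_cvg h; split; first by apply/cvg_ex; exists l.
exact: (@cvg_lim R[i]^o (@norm_hausdorff _ R[i]^o) _ _ _ _ _ h).
Qed.

Lemma has_csum_uniq f l l' : has_csum D f l -> has_csum D f l' -> l = l'.
Proof. by move=> /has_csum_csum[_ <-] /has_csum_csum[_ <-]. Qed.

Lemma has_csum_ext f f' l : (forall x, D x -> f x = f' x) ->
  has_csum D f l -> has_csum D f' l.
Proof.
move=> ff h e /h[A DA hA]; exists A => // B DB /(hA _ DB).
congr (`| _ - _ | < _); apply: eq_fsbigr => x; rewrite inE => /(DB.2 _).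
exact: ff.
Qed.

Lemma has_csum_addZ f g l m (c : R[i]) : has_csum D f l -> has_csum D g m ->
  has_csum D (fun x => f x + c * g x) (l + c * m).
Proof.
move=> hf hg e e0.
have c0 : 0 < `|c| + 1 by rewrite ltr_wpDl.
have [A DA hA] := hf _ (divr_gt0 e0 (ltr0n _ 2)).
have [B DB hB] := hg _ (divr_gt0 (divr_gt0 e0 (ltr0n _ 2)) c0).
exists (A `|` B).
  by split; [rewrite finite_setU; split; [case: DA|case: DB]
           | rewrite subUset; split; [case: DA|case: DB]].
move=> C DC; rewrite subUset => -[AC BC].
rewrite fsbig_split /=; last by case: DC.
rewrite -mulr_fsumr opprD addrACA -mulrBr.
apply: (le_lt_trans (ler_normD _ _)).
rewrite [e]splitr ltr_leD ?hA // normrM.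
apply: (@le_trans _ _ ((`|c| + 1) * (e / 2 / (`|c| + 1)))).
  by rewrite ler_pM // ?lerDl // ltW // hB.
by rewrite mulrC divfK // gt_eqF.
Qed.

Lemma has_csum0 : has_csum D (fun=> 0) 0.
Proof.
move=> e e0; exists set0; first exact: fsets_set0.
by move=> B _ _; rewrite fsbig1 // subr0 normr0.
Qed.

Lemma has_csumZ f l (c : R[i]) : has_csum D f l ->
  has_csum D (fun x => c * f x) (c * l).
Proof.
move=> h; rewrite -[c * l]add0r.
by apply: has_csum_ext (has_csum_addZ _ has_csum0 h) => x _; rewrite add0r.
Qed.

(** Monotone convergence: the sum is the supremum of the finite partial sums. *)
Lemma has_csum_ge0 (g : T -> R) : (forall x, D x -> 0 <= g x) ->
  sum_bounded D g -> exists l, has_csum D (fun x => (g x)%:C%C) l.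
Proof.
move=> g0 [C hC].
pose S := [set \sum_(x \in A) g x | A in fsets D].
have supS : has_sup S.
  split; first by exists (\sum_(x \in set0) g x), set0 => //; exact: fsets_set0.
  by exists C => _ [A DA <-]; exact: hC.
(* In the partial order of [R[i]], [0 < e] forces [e] to be real. *)
exists (sup S)%:C%C => e; rewrite ltcE /= => /andP[/eqP Ime e0].
have -> : e = (complex.Re e)%:C%C by case: e Ime {e0} => a b /= ->.
have [_ [A DA <-] hA] := sup_adherent e0 supS.
exists A => // B DB AB.
rewrite (_ : \sum_(x \in B) _ = (\sum_(x \in B) g x)%:C%C); last first.
  by rewrite !fsbig_finite ?rmorph_sum //; case: DB.
rewrite -rmorphB /= normc_def /= expr0n addr0 sqrtr_sqr ltcR.
have lB : \sum_(x \in B) g x <= sup S by apply: (sup_upper_bound supS); exists B.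
rewrite ger0_norm ?subr_ge0 // ltrBlDr -ltrBlDl.
apply: (lt_le_trans hA).
rewrite [leRHS](fsbigID A) /=; last by case: DB.
by rewrite (setIidr AB) lerDl; apply: fsumr_ge0 => x [/DB.2 Dx _]; exact: g0.
Qed.

Lemma sum_bounded_le (g h : T -> R) : (forall x, D x -> h x <= g x) ->
  sum_bounded D g -> sum_bounded D h.
Proof.
move=> hg [C hC]; exists C => A DA; apply: le_trans (hC A DA).
rewrite !fsbig_finite; try by case: DA.
rewrite big_seq [leRHS]big_seq; apply: ler_sum => x.
by rewrite in_fset_set ?inE => [/(DA.2)/hg//|]; case: DA.
Qed.

(** Comparison test: the real and imaginary parts are split into positive and negative parts, and
    each of the four nonnegative families is summed by [has_csum_ge0]. *)
Lemma has_csum_bounded f (g : T -> R) : sum_bounded D g ->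
  (forall x, D x -> `|f x| <= (g x)%:C%C) -> exists l, has_csum D f l.
Proof.
move=> hg fg.
have fRe x : D x -> `|complex.Re (f x)| <= g x.
  by move=> Dx; rewrite -lecR; apply: le_trans (fg _ Dx); exact: normc_ge_Re.
have fIm x : D x -> `|complex.Im (f x)| <= g x.
  move=> Dx; rewrite -lecR; apply: le_trans (fg _ Dx).
  have := normc_ge_Re (f x * 'i%C); rewrite ReiNIm normrN normrM.
  by rewrite complexiE normCi mulr1.
have posp (r : T -> R) : (forall x, D x -> `|r x| <= g x) ->
    exists l, has_csum D (fun x => (r x)%:C%C) l.
  move=> rg.
  have [||l hl] := @has_csum_ge0 (fun x => Num.max (r x) 0).
  - by move=> x _; rewrite le_max lexx orbT.
  - apply: sum_bounded_le hg => x Dx; rewrite ge_max.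
    by rewrite (le_trans (ler_norm _) (rg _ Dx)) (le_trans _ (rg _ Dx)).
  have [||m hm] := @has_csum_ge0 (fun x => Num.max (- r x) 0).
  - by move=> x _; rewrite le_max lexx orbT.
  - apply: sum_bounded_le hg => x Dx; rewrite ge_max.
    by rewrite (le_trans (ler_norm _)) ?normrN ?rg // (le_trans _ (rg _ Dx)).
  exists (l + (-1) * m); apply: has_csum_ext (has_csum_addZ _ hl hm) => x _.
  rewrite mulN1r -rmorphB /=; congr (_%:C)%C.
  by rewrite !maxEle; do 2 case: ifPn; rewrite -?ltNge; lra.
have [l hl] := posp _ fRe; have [m hm] := posp _ fIm.
exists (l + 'i%C * m); apply: has_csum_ext (has_csum_addZ _ hl hm) => x _.
by rewrite -complexE.
Qed.

Lemma has_csum_finite f : finite_set D -> has_csum D f (\sum_(x \in D) f x).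
Proof.
move=> finD e e0; exists D; first by split.
move=> B [_ BD] DB; have -> : B = D by apply/seteqP.
by rewrite subrr normr0.
Qed.

Lemma sum_boundedS (D' : set T) (g : T -> R) : D' `<=` D ->
  sum_bounded D g -> sum_bounded D' g.
Proof.
by move=> DD [C hC]; exists C => A [fA AD]; apply: hC; split => // x /AD/DD.
Qed.

End FixedDomain.

Lemma has_csum_image (T U : choiceType) (D : set T) (h : T -> U)
    (f : U -> R[i]) l : set_inj D h ->
  has_csum D (f \o h) l -> has_csum (h @` D) f l.
Proof.
move=> hinj H e /H[A [fA AD] hA]; exists (h @` A).
  by split; [exact: finite_image | exact: image_subset].
move=> B [fB BD] AB.
have inj' : set_inj (D `&` h @^-1` B) h.
  by move=> x y; rewrite !inE => -[Dx _] [Dy _]; apply: hinj; rewrite inE.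
have EB : h @` (D `&` h @^-1` B) = B.
  apply/seteqP; split => [_ [x [_ Bx] <-] //|y By].
  by have [x Dx xy] := BD _ By; exists x => //; split => //=; rewrite xy.
rewrite -EB fsbig_image //; apply: hA.
  split; last exact: subIsetl.
  by rewrite -(eq_finite_set (inj_card_eq inj')) EB.
by move=> x Ax; split; [exact: AD | apply: AB; exists x].
Qed.

(** A finite part of the sum over E is approximated by a finite sum over D: each fibre sum is
    replaced by a finite one that keeps the points of A in that fibre, so that the convergence over
    D applies to the union. *)
Lemma has_csum_fiber (T U : choiceType) (D : set T) (E : set U) (p : T -> U)
    (f : T -> R[i]) (g : U -> R[i]) l :
  (forall x, D x -> E (p x)) ->
  has_csum D f l ->
  (forall u, E u -> has_csum (D `&` p @^-1` [set u]) f (g u)) ->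
  has_csum E g l.
Proof.
move=> DE hf hg e e0.
have e20 : 0 < e / 2 by rewrite divr_gt0.
have [A [fA AD] hA] := hf _ e20.
exists (p @` A).
  by split; [exact: finite_image | move=> _ [x /AD Ax <-]; exact: DE].
move=> B [fB BE] AB.
(* The error budget is halved at each new fibre, so the total stays below [e'] whatever the length
   of the list. *)
have key (s : seq U) : uniq s -> (forall u, u \in s -> E u) -> forall e', 0 < e' ->
    exists C, [/\ fsets (D `&` [set x | p x \in s]) C,
     A `&` [set x | p x \in s] `<=` C &
     `|\sum_(u <- s) g u - \sum_(x \in C) f x| < e'].
  elim: s => [_ _ e' e'0|u s ih /= /andP[us uns] sE e' e'0].
    exists set0; split; first exact: fsets_set0.
    - by move=> x [].
    - by rewrite big_nil fsbig_set0 subr0 normr0.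
  have e'2 : 0 < e' / 2 by rewrite divr_gt0.
  have [v vs|C [[fC CD] AC hC]] := ih uns _ _ e'2.
    by apply: sE; rewrite inE vs orbT.
  have [|C' [fC' C'D] hC'] := hg u _ _ e'2; first by apply: sE; rewrite mem_head.
  pose C1 := C' `|` (A `&` p @^-1` [set u]).
  have fC1 : fsets (D `&` p @^-1` [set u]) C1.
    split; first by rewrite finite_setU; split => //; exact: finite_setIl.
    by move=> x [/C'D//|[/AD Dx ux]].
  exists (C `|` C1); split.
  - split; first by rewrite finite_setU; split => //; case: fC1.
    move=> x [/CD[Dx /= xs]|/(fC1.2)[Dx /= xu]]; split => //=; rewrite inE.
      by rewrite xs orbT.
    by rewrite xu eqxx.
  - move=> x [Ax /=]; rewrite inE => /orP[/eqP xu|xs]; last by left; apply: AC.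
    by right; right.
  - rewrite fsbigU //=; last 2 first.
    + by case: fC1.
    + move=> x [/CD[_ /= xs] /(fC1.2)[_ /= xu]].
      by move: us; rewrite -xu xs.
    rewrite big_cons addrC [X in _ + _ - X]/= opprD addrACA.
    apply: (le_lt_trans (ler_normD _ _)); rewrite [e']splitr ltrD //.
    by apply: hC' => //; exact: subsetUl.
have [|u|C [[fC CD] AC hC]] := key (fset_set B) _ _ _ e20.
- exact: fset_uniq.
- by rewrite in_fset_set // inE; exact: BE.
rewrite fsbig_finite //.
have fCD : fsets D C by split => // x /CD[].
have AsC : A `<=` C.
  by move=> x Ax; apply: AC; split => //=; rewrite in_fset_set // inE; apply: AB; exists x.
have := hA _ fCD AsC.
move: hC; set a := (\sum_(u <- _) _); set b := (\sum_(x \in C) _) => h1 h2.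
have -> : l - a = (l - b) - (a - b) by rewrite opprB addrA subrK.
by rewrite (le_lt_trans (ler_normB _ _)) // [e]splitr ltrD.
Qed.

Lemma sum_le_fiber (T U : choiceType) (D : set T) (E : set U) (p : T -> U)
    (f : T -> R) (g : U -> R) C :
  (forall x, D x -> E (p x)) -> sum_le E g C ->
  (forall u, E u -> sum_le (D `&` p @^-1` [set u]) f (g u)) ->
  sum_le D f C.
Proof.
move=> DE hC H A [fA AD].
have fpA : finite_set (p @` A) by exact: finite_image.
rewrite (@fsbig_fiber _ _ _ p _ _ (p @` A)) //.
have pAE : p @` A `<=` E by move=> _ [x /AD/DE Ex <-].
have /hC : fsets E (p @` A) by [].
apply: le_trans; rewrite !fsbig_finite // big_seq [leRHS]big_seq; apply: ler_sum => u.
rewrite in_fset_set // inE => /pAE Eu; apply: H => //.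
by split; [exact: finite_setIl | exact: setSI].
Qed.

Lemma sum_bounded_fiber (T U : choiceType) (D : set T) (E : set U) (p : T -> U)
    (f : T -> R) (g : U -> R) :
  (forall x, D x -> E (p x)) -> sum_bounded E g ->
  (forall u, E u -> sum_le (D `&` p @^-1` [set u]) f (g u)) ->
  sum_bounded D f.
Proof. by move=> DE [C hC] H; exists C; exact: sum_le_fiber H. Qed.

Lemma sum_leX (T U : choiceType) (D : set T) (E : set U)
    (f : T -> R) (g : U -> R) C C' : (forall x, D x -> 0 <= f x) ->
  sum_le D f C -> sum_le E g C' ->
  sum_le (D `*` E) (fun x => f x.1 * g x.2) (C * C').
Proof.
move=> f0 hC hC'.
have C'0 : 0 <= C' by apply: le_trans (hC' set0 (fsets_set0 _)); rewrite fsbig_set0.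
apply: (@sum_le_fiber _ _ _ D fst _ (fun x => f x * C')).
- by move=> x [].
- move=> A /hC hA; apply: le_trans (ler_wpM2r C'0 hA).
  by rewrite mulr_fsuml.
- move=> u Du A [fA AD].
  have -> : \sum_(x \in A) f x.1 * g x.2 = \sum_(x \in A) f u * g x.2.
    by apply: eq_fsbigr => x; rewrite inE => /AD[_ /= ->].
  rewrite -mulr_fsumr ler_wpM2l ?f0 //.
  suff <- : \sum_(y \in snd @` A) g y = \sum_(x \in A) g x.2.
    apply: hC'; split; first exact: finite_image.
    by move=> _ [x /AD[[_ Ex] _] <-].
  rewrite fsbig_image // => -[x y] [x' y']; rewrite !inE => /AD[_ /= ->].
  by move=> /AD[_ /= ->] ->.
Qed.

Lemma sum_boundedX (T U : choiceType) (D : set T) (E : set U)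
    (f : T -> R) (g : U -> R) : (forall x, D x -> 0 <= f x) ->
  sum_bounded D f -> sum_bounded E g ->
  sum_bounded (D `*` E) (fun x => f x.1 * g x.2).
Proof. by move=> f0 [C hC] [C' hC']; exists (C * C'); exact: sum_leX. Qed.

(** A choice of preimages carries a finite subset of E to a finite subset of D with the same sum.
    This serves parametrisations that may reach a term several times. *)
Lemma sum_le_surj (T U : choiceType) (D : set T) (E : set U) (h : T -> U)
    (g : U -> R) C : E `<=` h @` D -> sum_le D (g \o h) C -> sum_le E g C.
Proof.
move=> Eh hC B [fB BE].
have [[u0 Bu0]|B0] := pselect (exists u, B u); last first.
  have -> : B = set0 by apply/seteqP; split=> // u Bu; case: B0; exists u.
  by have := hC set0 (fsets_set0 _); rewrite !fsbig_set0.
have [x0 Dx0 _] := Eh _ (BE _ Bu0).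
have /choice[r rP] u : exists x, B u -> D x /\ h x = u.
  by case: (pselect (B u)) => [/BE/Eh[x Dx hx]|nB]; [exists x|exists x0].
have rinj : set_inj B r.
  move=> u v; rewrite !inE => /rP[_ hu] /rP[_ hv] uv.
  by rewrite -hu uv.
have <- : \sum_(x \in r @` B) (g \o h) x = \sum_(u \in B) g u.
  rewrite fsbig_image //; apply: eq_fsbigr => u; rewrite inE => Bu /=.
  by have [_ ->] := rP u Bu.
apply: hC; split; first exact: finite_image.
by move=> _ [u /rP[Du _] <-].
Qed.

(** Turns convergence into finiteness: it will show that finitely many primitive lattices have a
    given annihilator, since all of them have the same index. *)
Lemma sum_bounded_finite (T : choiceType) (D : set T) (c : R) : 0 < c ->
  sum_bounded D (fun=> c) -> finite_set D.
Proof.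
move=> c0 [C hC]; apply: contrapT => infD.
have [B BD kB] := infinite_set_fset (Num.trunc (C / c)).+1 infD.
have /hC : fsets D [set` B] by split => //; exact: finite_fset.
rewrite fsbig_finite ?finite_fset //= set_fsetK big_const_seq count_predT.
rewrite iter_addr_0 leNgt -mulr_natl -ltr_pdivrMr // => /negP; apply.
by rewrite (lt_le_trans (truncnS_gt (C / c))) // ler_nat.
Qed.

End HasSum.

(** * Complex powers of natural numbers *)

Section ComplexPowerTheory.
Variable R : realType.
Implicit Types (s z w : R[i]) (n m : nat).

Lemma cexpD z w : cexp (z + w) = cexp z * cexp w.
Proof.
case: z w => [a b] [c d]; rewrite /cexp /= expRD cosD sinD.
by apply/eqP; rewrite eq_complex /=; apply/andP; split; apply/eqP; ring.
Qed.

Lemma norm_cexp z : `|cexp z| = (expR (complex.Re z))%:C%C.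
Proof.
rewrite /cexp normrM !normc_def /= expr0n addr0 cos2Dsin2 sqrtr1 mulr1.
by rewrite sqrtr_sqr ger0_norm ?expR_ge0.
Qed.

Lemma natcpowM n m s : (0 < n)%N -> (0 < m)%N ->
  natcpow (n * m) s = natcpow n s * natcpow m s.
Proof.
move=> n0 m0; rewrite /natcpow natrM lnM ?posrE ?ltr0n // rmorphD mulrDr.
by rewrite cexpD.
Qed.

Lemma natcpowD n s z : natcpow n (s + z) = natcpow n s * natcpow n z.
Proof. by rewrite /natcpow mulrDl cexpD. Qed.

Lemma natcpow1 n : (0 < n)%N -> natcpow n 1 = n%:R :> R[i].
Proof.
move=> n0; rewrite /natcpow mul1r /cexp /= cos0 sin0 lnK ?posrE ?ltr0n //.
by rewrite -[Complex 1 0]/(1 : R[i]) mulr1 rmorph_nat.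
Qed.

Lemma natcpowB1 n s : (0 < n)%N -> natcpow n s = natcpow n (s - 1) * n%:R.
Proof. by move=> n0; rewrite -(natcpow1 n0) -natcpowD subrK. Qed.

Lemma natcpow2 n s : natcpow n (2 * s) = natcpow n s * natcpow n s.
Proof. by rewrite mulrDl mul1r natcpowD. Qed.

Lemma norm_natcpow n s : (0 < n)%N ->
  `|natcpow n s| = (n%:R `^ complex.Re s)%:C%C.
Proof.
move=> n0; rewrite norm_cexp /powR pnatr_eq0 gtn_eqF //.
by case: s => a b /=; rewrite mulr0 subr0.
Qed.

End ComplexPowerTheory.

(** * Indices of submodules *)

Lemma set_card_range (U : finType) (T : choiceType) (f : U -> T) (D : set T) :
  injective f -> range f = D -> finite_set D /\ set_card D = #|U|.
Proof.
move=> finj fD; have finU : finite_set [set: U] by exact: finite_finset.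
have finD : finite_set D by rewrite -fD; exact: finite_image.
split=> //; rewrite /set_card -fD fset_set_image // card_imfset //=.
rewrite [RHS]cardE; apply: perm_size; apply: uniq_perm; [exact: fset_uniq | exact: enum_uniq |].
by move=> x; rewrite in_fset_set // mem_enum mem_set.
Qed.
 
Lemma finite_set_ord (T : choiceType) (D : set T) : finite_set D ->
  exists f : 'I_(set_card D) -> T, injective f /\ range f = D.
Proof.
move=> finD; pose s := enum_fset (fset_set D).
exists (fun i => tnth (in_tuple s) i); split.
  by apply/tuple_uniqP; exact: fset_uniq.
apply/seteqP; split => [_ [i _ <-]|x Dx].
  have : tnth (in_tuple s) i \in s by exact: mem_tnth.
  by rewrite /s (in_fset_set finD) inE.
have /tnthP[i ->] : x \in in_tuple s by rewrite /s (in_fset_set finD) inE.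
by exists i.
Qed.

Lemma set_card_inj (T U : choiceType) (D : set T) (h : T -> U) : finite_set D ->
  set_inj D h -> finite_set (h @` D) /\ set_card (h @` D) = set_card D.
Proof.
move=> /finite_set_ord[f [finj fD]] hinj.
have fDi i : D (f i) by rewrite -fD; exists i.
have -> : set_card D = #|'I_(set_card D)| by rewrite card_ord.
apply: (@set_card_range _ _ (h \o f)); last first.
  transitivity (h @` range f); first by rewrite image_comp.
  by rewrite fD.
by move=> i j /= /hinj; rewrite !inE => /(_ (fDi i) (fDi j))/finj.
Qed.

Section Index.
Variable A : comNzRingType.

(** [module_index] is 0 on an infinite quotient, so finiteness is carried separately. *)
Definition fin_index (V : lmodType A) (M : set V) : Prop :=
  finite_set (quotient_set setT (fun x y : V => M (x - y))).

(** [phi] plays the role of the quotient map V -> V / M. An index is computed by exhibiting such a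
    map onto a finite type of known cardinality. *)
Definition classifies (V : lmodType A) (U : Type) (phi : V -> U) (M : set V) :=
  (forall u, exists x, phi x = u) /\ forall x y, phi x = phi y <-> M (x - y).

Section Submodule.
Variable V : lmodType A.
Implicit Types M N : set V.

Lemma submoduleP M : submodule M <->
  M 0 /\ forall a u v, M u -> M v -> M (a *: u + v).
Proof.
rewrite /submodule /submod_closed; split=> -[h0 h]; split.
- by have := h0; rewrite inE.
- by move=> a u v Mu Mv; have := h a u v; rewrite !inE; apply.
- by rewrite inE.
- by move=> a u v; rewrite !inE; exact: h.
Qed.

Lemma submod0 M : submodule M -> M 0.
Proof. by case/submoduleP. Qed.

Lemma submodZ M a u : submodule M -> M u -> M (a *: u).
Proof. by case/submoduleP => M0 h Mu; rewrite -[_ *: _]addr0; exact: h. Qed.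

Lemma submodD M u v : submodule M -> M u -> M v -> M (u + v).
Proof. by case/submoduleP => M0 h Mu Mv; rewrite -[u]scale1r; exact: h. Qed.

Lemma submodN M u : submodule M -> M u -> M (- u).
Proof. by move=> sM Mu; rewrite -scaleN1r; exact: submodZ. Qed.

Lemma submodB M u v : submodule M -> M u -> M v -> M (u - v).
Proof. by move=> sM Mu Mv; apply: submodD => //; exact: submodN. Qed.

Lemma submod_subr M u v : submodule M -> M (u - v) -> M (v - u).
Proof. by move=> sM /(submodN sM); rewrite opprB. Qed.

Lemma submod_trans M v u w : submodule M -> M (u - v) -> M (v - w) -> M (u - w).
Proof. by move=> sM h1 h2; rewrite -(subrKA v); exact: submodD. Qed.

Lemma submod_congr M u v : submodule M -> M (u - v) -> M u <-> M v.
Proof.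
move=> sM h; split=> [Mu|Mv]; last by rewrite -(subrK v u); exact: submodD.
by rewrite -[v](subKr u); exact: submodB.
Qed.

Lemma classifies_index (U : finType) (phi : V -> U) M : classifies phi M ->
  fin_index M /\ module_index M = #|U|.
Proof.
move=> [phis phiP]; apply: (@set_card_range _ _ (fun u => [set y | phi y = u])).
  move=> u v uv; have [x xu] := phis u.
  by have : [set y | phi y = u] x by []; rewrite uv /= xu.
apply/seteqP; split => [_ [u _ <-]|_ [x _ <-]].
  have [x <-] := phis u; exists x => //; apply/seteqP; split => y /=.
    by move=> [_ /phiP ->].
  by move=> yx; split=> //; apply/phiP.
exists (phi x) => //; apply/seteqP; split => y /=.
  by move=> yx; split=> //; apply/phiP.
by move=> [_ /phiP ->].
Qed.

Lemma fin_index_classifies M : submodule M -> fin_index M ->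
  exists phi : V -> 'I_(module_index M), classifies phi M.
Proof.
move=> sM finM; have [f [finj fQ]] := finite_set_ord finM.
have cls x : exists i, f i = [set y | setT y /\ M (x - y)].
  have : range f [set y | setT y /\ M (x - y)] by rewrite fQ; exists x.
  by case=> i _ <-; exists i.
exists (fun x => projT1 (cid (cls x))); split.
  move=> i; have : range f (f i) by exists i.
  rewrite fQ => -[x _ xi]; exists x; case: cid => j /= ji.
  by apply: finj; rewrite ji.
move=> x y; case: cid => i /= ix; case: cid => j /= jy; split.
  move=> ij; move: ix; rewrite ij jy => E.
  have : [set y0 | [set: V] y0 /\ M (y - y0)] y.
    by split=> //; rewrite subrr; exact: submod0.
  by rewrite E => -[].
move=> xy; apply: finj; rewrite ix jy; apply/seteqP; split => z /= [_ h]; split=> //.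
  by apply: submod_trans h => //; exact: submod_subr.
by apply: submod_trans h.
Qed.

Lemma module_index_gt0 M : submodule M -> fin_index M -> (0 < module_index M)%N.
Proof.
by move=> sM /(fin_index_classifies sM)[phi _]; exact: leq_ltn_trans (ltn_ord (phi 0)).
Qed.

(** Classes modulo M surject onto classes modulo N, and a surjection between finite sets of equal
    size is injective. The equality case makes the index a measure for inductions on growing
    ideals. *)
Lemma fin_indexS M N : submodule M -> submodule N -> M `<=` N -> fin_index M ->
  fin_index N /\ (module_index N <= module_index M ?= iff `[< N `<=` M >])%N.
Proof.
move=> sM sN MN finM; have [phi [phis phiP]] := fin_index_classifies sM finM.
pose rho i := projT1 (cid (phis i)).
have rhoK i : phi (rho i) = i by rewrite /rho; case: cid.
have rhoM x : M (rho (phi x) - x) by apply/phiP.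
have finN : fin_index N.
  apply: (@sub_finite_set _ _ (range (fun i => [set y | setT y /\ N (rho i - y)]))).
    move=> _ [x _ <-]; exists (phi x) => //; apply/seteqP.
    have xx := MN _ (rhoM x).
    split=> y /= [_ h]; split=> //.
      by apply: submod_trans h => //; exact: submod_subr.
    by apply: submod_trans h.
  by apply: finite_image; exact: finite_finset.
split=> //; have [psi [psis psiP]] := fin_index_classifies sN finN.
pose h i := psi (rho i).
have hphi x : h (phi x) = psi x by apply/psiP/MN.
have hs : codom h =i predT.
  move=> j; rewrite [RHS]inE; have [x <-] := psis j.
  by apply/codomP; exists (phi x); rewrite hphi.
have leh : (module_index N <= module_index M
    ?= iff [forall x, forall y, (h x == h y) ==> (x == y)])%N.
  have Ec : #|codom h| = module_index N by rewrite (eq_card hs) card_ord.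
  split; first by rewrite -Ec -[leqRHS]card_ord; exact: leq_image_card.
  rewrite -{1}Ec -[X in _ == X]card_ord.
  apply/image_injP/forallP => [hi x|hi x y _ _ xy].
    by apply/forallP => y; apply/implyP => /eqP xy; apply/eqP/hi.
  by apply/eqP; move: (hi x) => /forallP/(_ y); rewrite xy eqxx.
case: leh => h1 h2; split=> //; rewrite h2.
apply/forallP/asboolP => [hi x Nx|NM i].
  have /eqP : phi x == phi 0.
    have /forallP/(_ (phi 0))/implyP := hi (phi x); rewrite !hphi; apply.
    by apply/eqP/psiP; rewrite subr0.
  by move/phiP; rewrite subr0.
apply/forallP => j.
by apply/implyP => /eqP/psiP/NM/phiP; rewrite !rhoK => ->; exact: eqxx.
Qed.

(** Gives finiteness and the bound at once; for the ring of integers modulo m, only a coincidence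
    among many elements has to be produced. *)
Lemma fin_index_pigeonhole M k : submodule M ->
  (forall x : 'I_k.+1 -> V, exists i j, i != j /\ M (x i - x j)) ->
  fin_index M /\ (module_index M <= k)%N.
Proof.
move=> sM H.
have key (B : {fset set V}) :
    [set` B] `<=` quotient_set setT (fun x y : V => M (x - y)) -> (#|` B| <= k)%N.
  move=> BQ; rewrite leqNgt; apply/negP => kB.
  have cls (i : 'I_k.+1) : exists x, nth set0 B i = [set y | setT y /\ M (x - y)].
    have : [set` B] (nth set0 B i) by rewrite /= mem_nth // (leq_trans (ltn_ord i)).
    by move=> /BQ[x _ <-]; exists x.
  pose x i := projT1 (cid (cls i)).
  have xP (i : 'I_k.+1) : nth set0 B i = [set y | setT y /\ M (x i - y)] by rewrite /x; case: cid.
  have [i [j [ij Mij]]] := H x.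
  have : nth set0 B i = nth set0 B j.
    rewrite !xP; apply/seteqP; split=> z /= [_ h]; split=> //.
      by apply: submod_trans h => //; exact: submod_subr.
    by apply: submod_trans h.
  move/eqP; rewrite nth_uniq ?fset_uniq ?(leq_trans (ltn_ord _)) //.
  by move=> /eqP/val_inj/eqP; rewrite (negbTE ij).
have finM : fin_index M.
  apply: contrapT => /(infinite_set_fset k.+1)[B BQ kB].
  by have := key B BQ; rewrite leqNgt kB.
split=> //; apply: key => X; rewrite /= in_fset_set // inE.
exact.
Qed.

Lemma incongruent_leq_index M k (x : 'I_k -> V) : submodule M -> fin_index M ->
  (forall i j, M (x i - x j) -> i = j) -> (k <= module_index M)%N.
Proof.
move=> sM /(fin_index_classifies sM)[phi [_ phiP]] H.
have /leq_card : injective (phi \o x) by move=> i j /phiP/H.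
by rewrite !card_ord.
Qed.

Lemma module_index_setT : module_index [set: V] = 1%N /\ fin_index [set: V].
Proof.
have [|//] := @classifies_index _ (fun=> tt) setT; last by rewrite card_unit.
by split=> [[]|]; first by exists 0.
Qed.

End Submodule.

(** [t] presents N / M as W / P. It will be the inclusion of the first axis, and multiplication by
    an element that generates an ideal I modulo a multiple of I. *)
Lemma module_index_tower (V W : lmodType A) (M N : set V) (P : set W)
    (t : W -> V) : submodule M -> submodule N -> submodule P -> M `<=` N ->
  (forall w, N (t w)) -> (forall n, N n -> exists w, M (n - t w)) ->
  (forall w w', M (t w - t w') <-> P (w - w')) ->
  fin_index N -> fin_index P ->
  fin_index M /\ module_index M = (module_index N * module_index P)%N.
Proof.
move=> sM sN sP MN tN Nt tP finN finP.
have [phi [phis phiP]] := fin_index_classifies sN finN.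
have [psi [psis psiP]] := fin_index_classifies sP finP.
have /choice[rho rhoK] := phis.
have /choice[g gP] : forall n, exists w, N n -> M (n - t w).
  by move=> n; case: (pselect (N n)) => [/Nt[w]|]; [exists w|exists 0].
have Nrho x : N (x - rho (phi x)) by apply/phiP; rewrite rhoK.
(* The class modulo N, and the class in W / P of the difference from the chosen representative. *)
pose chi x := (phi x, psi (g (x - rho (phi x)))).
rewrite -[X in (X * _)%N]card_ord -[X in (_ * X)%N]card_ord -card_prod.
apply: (@classifies_index _ _ chi); split.
  move=> [u v]; have [w wv] := psis v; exists (rho u + t w).
  have phiu : phi (rho u + t w) = u.
    by rewrite -[RHS]rhoK; apply/phiP; rewrite addrAC subrr add0r.
  rewrite /chi phiu addrAC subrr add0r -wv; congr pair; apply/psiP.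
  by apply/tP; apply: submod_subr => //; exact: gP.
move=> x y; rewrite /chi; split=> [[xy]|Mxy].
  move=> /psiP/tP Mg; have Nx := Nrho x; have Ny := Nrho y.
  move: Mg Nx Ny; rewrite xy; set r := rho _ => Mg /gP Mx /gP My.
  have := submod_trans sM Mx (submod_trans sM Mg (submod_subr sM My)).
  by rewrite opprB addrA subrK.
have xy : phi x = phi y by apply/phiP/MN.
rewrite xy; congr pair; apply/psiP/tP.
have Nx := Nrho x; have Ny := Nrho y.
move: Nx Ny; rewrite xy; set r := rho _ => /gP Mx /gP My.
apply: submod_trans (submod_subr sM Mx) _ => //; apply: submod_trans My => //.
by rewrite opprB addrA subrK.
Qed.

Lemma module_indexX (V W : lmodType A) (M : set V) (N : set W) :
  submodule M -> submodule N -> fin_index M -> fin_index N ->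
  let MN : set (V * W)%type := M `*` N in
  fin_index MN /\ module_index MN = (module_index M * module_index N)%N.
Proof.
move=> sM sN finM finN MN.
have [phi [phis phiP]] := fin_index_classifies sM finM.
have [psi [psis psiP]] := fin_index_classifies sN finN.
rewrite -[X in (X * _)%N]card_ord -[X in (_ * X)%N]card_ord -card_prod.
apply: (@classifies_index _ _ (fun v : V * W => (phi v.1, psi v.2))); split.
  by move=> [i j]; have [x <-] := phis i; have [y <-] := psis j; exists (x, y).
move=> [x x'] [y y'] /=; split=> [[/phiP Mx /psiP Nx]|[/= /phiP -> /psiP ->]//].
by split.
Qed.

End Index.

(** * Stable range modulo an ideal *)

Section Ideals.
Variable A : comNzRingType.
Implicit Types (I J : set A) (a b x y : A).

Lemma idealP I : ideal I <-> [/\ I 0, forall x y, I x -> I y -> I (x + y)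
  & forall a x, I x -> I (a * x)].
Proof.
rewrite /ideal submoduleP; split=> [[I0 h]|[I0 hD hM]].
  have hM a x : I x -> I (a * x) by move=> Ix; rewrite -[_ * _]addr0; exact: h.
  by split=> // x y Ix Iy; rewrite -[x]mul1r; exact: h.
by split=> // a u v Iu Iv; apply: hD => //; exact: hM.
Qed.

Lemma ideal0 I : ideal I -> I 0. Proof. by case/idealP. Qed.
Lemma idealD I x y : ideal I -> I x -> I y -> I (x + y).
Proof. by case/idealP => _ + _; apply. Qed.
Lemma idealM I a x : ideal I -> I x -> I (a * x).
Proof. by case/idealP => _ _; apply. Qed.
Lemma idealMr I a x : ideal I -> I x -> I (x * a).
Proof. by rewrite mulrC; exact: idealM. Qed.
Lemma idealN I x : ideal I -> I x -> I (- x).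
Proof. by move=> iI; rewrite -mulN1r; exact: idealM. Qed.
Lemma idealB I x y : ideal I -> I x -> I y -> I (x - y).
Proof. by move=> iI Ix Iy; apply: idealD => //; exact: idealN. Qed.
Lemma ideal_congr I x y : ideal I -> I (x - y) -> I x <-> I y.
Proof. exact: (@submod_congr _ A^o). Qed.
Lemma ideal_subr I x y : ideal I -> I (x - y) -> I (y - x).
Proof. exact: (@submod_subr _ A^o). Qed.
Lemma ideal_trans I y x z : ideal I -> I (x - y) -> I (y - z) -> I (x - z).
Proof. exact: (@submod_trans _ A^o). Qed.

Lemma ideal_expB I x y k : ideal I -> I (x - y) -> I (x ^+ k - y ^+ k).
Proof. by move=> iI h; rewrite subrXX; exact: idealMr. Qed.

Lemma ideal_nilD I x y k l : ideal I -> I (x ^+ k) -> I (y ^+ l) ->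
  I ((x + y) ^+ (k + l)).
Proof.
move=> iI Ix Iy; rewrite exprDn; elim/big_ind: _ => [|u v|i _].
- exact: ideal0.
- exact: idealD.
- rewrite -mulr_natr; apply: idealMr => //.
  case: (leqP l i) => li; first by rewrite -(subnK li) exprD; do 2 apply: idealM => //.
  have ki : (k <= k + l - i)%N by rewrite -addnBA ?leq_addr // ltnW.
  by apply: idealMr => //; rewrite -(subnK ki) exprD; exact: idealM.
Qed.

Lemma ideal_idem_exp I x k : ideal I -> I (x * x - x) -> I (x ^+ k.+1 - x).
Proof.
move=> iI Ix; elim: k => [|k ih]; first by rewrite expr1 subrr; exact: ideal0.
apply: (ideal_trans iI _ Ix); rewrite exprS -mulrBr; exact: idealM.
Qed.

Lemma ideal_principal a : ideal (principal a).
Proof.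
apply/idealP; split=> [|x y [r _ <-] [s _ <-]|b x [r _ <-]].
- by exists 0 => //; rewrite mul0r.
- by exists (r + s) => //; rewrite mulrDl.
- by exists (b * r) => //; rewrite mulrA.
Qed.

Lemma principal_id a : principal a a.
Proof. by exists 1 => //; rewrite mul1r. Qed.

Lemma principal_sub I a : ideal I -> I a -> principal a `<=` I.
Proof. by move=> iI Ia _ [r _ <-]; exact: idealM. Qed.

Lemma ideal_setT I : ideal I -> I 1 -> I = setT.
Proof.
by move=> iI I1; apply/seteqP; split=> // x _; rewrite -[x]mulr1; exact: idealM.
Qed.

(** An idempotent power of b is 1 on the part of A / J where b is a unit and 0 where b is nilpotent.
    The exponent is positive, as [b ^+ 0] would be idempotent trivially. *)
Definition pi_regular J := forall b, exists k,
  J (b ^+ k.+1 * b ^+ k.+1 - b ^+ k.+1).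

Lemma fin_index_pi_regular J : ideal J -> fin_index (J : set A^o) ->
  pi_regular J.
Proof.
move=> iJ /(fin_index_classifies iJ)[phi [_ phiP]] b.
have [i [j [ij bij]]] : exists i j, (i < j)%N /\ J (b ^+ j - b ^+ i).
  have /injectivePn[i [j ij /phiP bij]] :
    ~~ injectiveb (fun i : 'I_(module_index (J : set A^o)).+1 => phi (b ^+ i)).
    apply/negP => /injectiveP/leq_card; by rewrite !card_ord ltnn.
  have [h|h|h] := ltngtP i j.
  - by exists i, j; split=> //; exact: ideal_subr.
  - by exists j, i; split.
  - by move: ij; rewrite (val_inj h) eqxx.
have [d d0 jE] : exists2 d, (0 < d)%N & j = (i + d)%N.
  by exists (j - i)%N; rewrite ?subn_gt0 ?subnKC // ltnW.
have per t m : J (b ^+ (i + t + d * m) - b ^+ (i + t)).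
  elim: m => [|m ih]; first by rewrite muln0 addn0 subrr; exact: ideal0.
  apply: (ideal_trans iJ _ ih); move: bij; rewrite jE => bij.
  have -> : b ^+ (i + t + d * m.+1) - b ^+ (i + t + d * m) =
      b ^+ t * b ^+ (d * m) * (b ^+ (i + d) - b ^+ i).
    by rewrite mulnS !exprD; ring.
  exact: idealM.
(* The powers of b have period d from exponent i on, and [d * i.+1] is a positive multiple of d that
   is at least i: doubling it does not change the power. *)
exists (d * i.+1).-1; rewrite prednK ?muln_gt0 ?d0 // -exprD.
have le : (i <= d * i.+1)%N by rewrite (leq_trans (leqnSn i)) // leq_pmull.
by have := per (d * i.+1 - i)%N i.+1; rewrite subnKC.
Qed.

Section StableRange.
Variables (V : lmodType A) (N : set V) (J : set A) (Phi : set (V -> A)).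
Hypotheses (sN : submodule N) (iJ : ideal J) (pJ : pi_regular J).
Hypothesis Phi_lin : forall f a u v, Phi f -> N u -> N v ->
  f (a *: u + v) = a * f u + f v.
Hypothesis Phi0 : Phi (fun=> 0).
Hypothesis PhiD : forall f g a b, Phi f -> Phi g ->
  Phi (fun m => a * f m + b * g m).

(** Idempotents modulo J that are values [f m] modulo J. Such an idempotent is enlarged until its
    complement vanishes. *)
Let idem e := J (e * e - e) /\
  exists m f, [/\ N m, Phi f & J (f m - e)].
(* Up to nilpotents modulo J, the element z lives on the idempotent e. *)
Let covers e z := exists k, J ((z * (1 - e)) ^+ k).
(** [J (e * e' - e)] says that e lies below e'. Starting from an arbitrary e allows elements to be
    covered one after another, which makes the coverable ones an ideal. *)
Let coverable z := forall e, idem e ->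
  exists e', [/\ idem e', J (e * e' - e) & covers e' z].

Lemma covers_mono e e' z : J (e * e' - e) -> covers e z -> covers e' z.
Proof.
move=> ee [k hk]; exists k.
apply/(@ideal_congr _ _ ((z * (1 - e)) ^+ k * (1 - e') ^+ k)) => //.
  rewrite -exprMn; apply: ideal_expB => //.
  have -> : z * (1 - e') - z * (1 - e) * (1 - e') = - z * (e * e' - e) by ring.
  exact: idealM.
exact: idealMr.
Qed.

Lemma idem_le_trans e2 e1 e3 : J (e1 * e2 - e1) -> J (e2 * e3 - e2) ->
  J (e1 * e3 - e1).
Proof.
move=> h1 h2.
have -> : e1 * e3 - e1 = - (e1 * e2 - e1) * e3 + e1 * (e2 * e3 - e2)
  + (e1 * e2 - e1) by ring.
by apply: idealD => //; apply: idealD => //; [apply: idealMr => //; exact: idealN|exact: idealM].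
Qed.

Lemma coverable_seq (s : seq A) : (forall z, z \in s -> coverable z) -> forall e, idem e ->
  exists e', [/\ idem e', J (e * e' - e) & forall z, z \in s -> covers e' z].
Proof.
elim: s => [_ e he|z s ih H e he]; first by exists e; split=> //; case: he.
have [e1 [h1 h2 h3]] := H z (mem_head _ _) _ he.
have [|e2 [h4 h5 h6]] := ih _ _ h1; first by move=> w ws; apply: H; rewrite inE ws orbT.
exists e2; split=> //; first exact: idem_le_trans h2 h5.
move=> w; rewrite inE => /orP[/eqP ->|]; last exact: h6.
exact: covers_mono h3.
Qed.

Lemma coverable_ideal : ideal coverable.
Proof.
apply/idealP; split=> [e he|x y Cx Cy e he|a x Cx e he].
- exists e; split=> //; first by case: he.
  by exists 1%N; rewrite mul0r expr1; exact: ideal0.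
- have [|e' [h1 h2 h3]] := @coverable_seq [:: x; y] _ e he.
    by move=> z; rewrite !inE => /orP[] /eqP ->.
  exists e'; split=> //.
  have [k hk] : covers e' x by apply: h3; rewrite inE eqxx.
  have [l hl] : covers e' y by apply: h3; rewrite !inE eqxx orbT.
  by exists (k + l)%N; rewrite mulrDl; exact: ideal_nilD.
- have [e' [h1 h2 [k h3]]] := Cx e he; exists e'; split=> //.
  by exists k; rewrite -mulrA exprMn; exact: idealM.
Qed.

(** Let h be an idempotent power of [(1 - e) * f m]. It is orthogonal to e, so e + h is idempotent;
    it is the value of [e f0 + h h' f] at [e m0 + h m], the cross terms being killed by e h; and
    what remains of [f m] outside e + h is nilpotent. *)
Lemma coverable_value f m : Phi f -> N m -> coverable (f m).
Proof.
move=> Pf Nm e [ee [m0 [f0 [Nm0 Pf0 fe]]]].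
have [k] := pJ ((1 - e) * f m); set h := (_ ^+ k.+1) => hh.
pose h' := (1 - e) * ((1 - e) * f m) ^+ k.
have hE : h = h' * f m by rewrite /h /h' exprS; ring.
have eh : J (e * h).
  have -> : e * h = - (e * e - e) * (((1 - e) * f m) ^+ k * f m).
    by rewrite /h exprS; ring.
  by apply: idealMr => //; exact: idealN.
pose r := 1 - e.
exists (e + h); split.
- split.
    have -> : (e + h) * (e + h) - (e + h) = (e * e - e) + (h * h - h) + 2 * (e * h).
      by ring.
    by apply: idealD => //; [apply: idealD|exact: idealM].
  exists (e *: m0 + h *: m), (fun m => e * f0 m + (h * h') * f m); split.
  + by apply: submodD => //; exact: submodZ.
  + exact: PhiD.
  + have Nhm : N (h *: m) by exact: submodZ.
    have lin g c u : Phi g -> N u -> g (c *: u) = c * g u.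
      move=> Pg Nu; have g0 : g 0 = 0.
        have /eqP := Phi_lin 1 Pg (submod0 sN) (submod0 sN).
        by rewrite scaler0 addr0 mul1r -subr_eq subrr eq_sym => /eqP.
      by rewrite -[c *: u]addr0 Phi_lin ?g0 ?addr0 //; exact: submod0.
    rewrite !Phi_lin // !lin //.
    have -> : e * (e * f0 m0 + h * f0 m) + h * h' * (e * f m0 + h * f m) - (e + h)
     = (e * e) * (f0 m0 - e) + (e + 1) * (e * e - e) + (e * h) * (f0 m + h' * f m0)
       + (h + 1) * (h * h - h) by rewrite hE; ring.
    by repeat apply: idealD => //; solve [exact: idealM | exact: idealMr].
- have -> : e * (e + h) - e = (e * e - e) + e * h by ring.
  exact: idealD.
- exists k.+1.
  apply/(@ideal_congr _ _ (((1 - e) * f m * (1 - h)) ^+ k.+1)) => //.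
    apply: ideal_expB => //.
    have -> : f m * (1 - (e + h)) - (1 - e) * f m * (1 - h) = - f m * (e * h) by ring.
    exact: idealM.
  rewrite exprMn -/h exprS mulrA; apply: idealMr => //.
  have -> : h * (1 - h) = - (h * h - h) by ring.
  exact: idealN.
Qed.

Let idem0 : idem 0.
Proof.
split; first by rewrite mul0r subrr; exact: ideal0.
exists 0, (fun=> 0); split=> //; first exact: submod0.
by rewrite subrr; exact: ideal0.
Qed.

Let coversP e z k : idem e -> J ((z * (1 - e)) ^+ k) ->
  exists k', J ((1 - e) * z ^+ k').
Proof.
move=> [ee _] hk; exists k; case: k hk => [|k hk].
  by rewrite expr0 => J1; rewrite (ideal_setT iJ J1).
apply/(@ideal_congr _ ((1 - e) * z ^+ k.+1) ((1 - e) ^+ k.+1 * z ^+ k.+1)) => //.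
  rewrite -mulrBl; apply: idealMr => //; apply: ideal_subr => //.
  apply: ideal_idem_exp => //.
  by have -> : (1 - e) * (1 - e) - (1 - e) = e * e - e by ring.
by rewrite -exprMn mulrC.
Qed.

(** The coverable elements form an ideal containing all values, hence 1. An idempotent that covers 1
    has a complement both idempotent and nilpotent, so it is 1 modulo J. *)
Lemma stable_range : (forall P, ideal P ->
    (forall f m, Phi f -> N m -> P (f m)) -> P 1) ->
  exists m f, [/\ N m, Phi f & J (f m - 1)].
Proof.
move=> /(_ _ coverable_ideal coverable_value) /(_ 0 idem0) [e [he _ [k /(coversP he)[k']]]].
rewrite expr1n mulr1 => J1e; case: he => _ [m [f [Nm Pf fe]]].
exists m, f; split=> //; apply: (ideal_trans iJ fe); exact: ideal_subr.
Qed.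

(** When the values generate a proper ideal, the process stops at an idempotent e, and 1 - e cuts
    out the part of A / J where the listed values are nilpotent. *)
Lemma idempotent_cover (s : seq A) :
  (forall z, z \in s -> exists f m, [/\ Phi f, N m & z = f m]) ->
  exists e, [/\ J (e * e - e), exists m f, [/\ N m, Phi f & J (f m - e)] &
    forall z, z \in s -> exists k, J ((1 - e) * z ^+ k)].
Proof.
move=> H; have [|e [he _ h]] := @coverable_seq s _ 0 idem0.
  by move=> z /H[f [m [Pf Nm ->]]]; exact: coverable_value.
exists e; split; [by case: he|by case: he|].
by move=> z /h[k /(coversP he)].
Qed.

End StableRange.

End Ideals.

(** * Ideals and lattices over a Dedekind domain with finite quotients *)

Section IdealProduct.
Variable A : comNzRingType.
Implicit Types (I J : set A) (a b x y : A).

(** The product I M as an intersection of submodules: inclusions out of it are checked on products,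
    without finite sums. *)
Definition smul (V : lmodType A) I (M : set V) : set V :=
  [set v | forall N, submodule N -> (forall a u, I a -> M u -> N (a *: u)) -> N v].

Section Module.
Variable V : lmodType A.
Implicit Types M N : set V.

Lemma submodI M : M 0 -> (forall u v, M u -> M v -> M (u + v)) ->
  (forall a u, M u -> M (a *: u)) -> submodule M.
Proof.
by move=> M0 MD MZ; apply/submoduleP; split=> // a u v Mu Mv; apply: MD => //; exact: MZ.
Qed.

Lemma submodule_setT : submodule [set: V].
Proof. exact: submodI. Qed.

Lemma smul_submod I M : submodule (smul I M).
Proof.
apply: submodI => [N sN _|u v hu hv N sN h|a u hu N sN h].
- exact: submod0.
- by apply: submodD; [|exact: hu|exact: hv].
- by apply: submodZ => //; exact: hu.
Qed.

Lemma smulZ I M a u : I a -> M u -> smul I M (a *: u).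
Proof. by move=> Ia Mu N sN; apply. Qed.

Lemma smul_sub I M N : submodule N -> (forall a u, I a -> M u -> N (a *: u)) ->
  smul I M `<=` N.
Proof. by move=> sN h v; exact. Qed.

Lemma smulS I M N : M `<=` N -> smul I M `<=` smul I N.
Proof.
move=> MN; apply: smul_sub; first exact: smul_submod.
by move=> a u Ia /MN; exact: smulZ.
Qed.

Definition colon I M : set V := [set v | forall a, I a -> M (a *: v)].

Lemma colon_submod I M : submodule M -> submodule (colon I M).
Proof.
move=> sM; apply: submodI => [a _|u v hu hv a Ia|b u hu a Ia].
- by rewrite scaler0; exact: submod0.
- by rewrite scalerDr; apply: submodD => //; [exact: hu|exact: hv].
- by rewrite scalerA mulrC -scalerA; apply: submodZ => //; exact: hu.
Qed.

Lemma preim_scale_ideal M v : submodule M -> ideal [set r | M (r *: v)].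
Proof.
move=> sM; apply/idealP; split=> /= [|x y hx hy|a x hx].
- by rewrite scale0r; exact: submod0.
- by rewrite scalerDl; exact: submodD.
- by rewrite -scalerA; exact: submodZ.
Qed.

Lemma preim_scale_submod M a : submodule M -> submodule [set v | M (a *: v)].
Proof.
move=> sM; apply: submodI => /= [|u v hu hv|b u hu].
- by rewrite scaler0; exact: submod0.
- by rewrite scalerDr; exact: submodD.
- by rewrite scalerA mulrC -scalerA; exact: submodZ.
Qed.

Lemma scale_submod M c : submodule M -> submodule [set c *: m | m in M].
Proof.
move=> sM; apply: submodI => [|_ _ [u Mu <-] [v Mv <-]|a _ [u Mu <-]].
- by exists 0; [exact: submod0|rewrite scaler0].
- by exists (u + v); [exact: submodD|rewrite scalerDr].
- by exists (a *: u); [exact: submodZ|rewrite !scalerA mulrC].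
Qed.

End Module.

(** On [A^o] this says that A is an integral domain. *)
Definition torsion_free (V : lmodType A) :=
  forall a (v : V), a *: v = 0 -> a = 0 \/ v = 0.

Lemma torsion_free_inj (V : lmodType A) a (u v : V) : torsion_free V ->
  a != 0 -> a *: u = a *: v -> u = v.
Proof.
move=> tf a0 /eqP; rewrite -subr_eq0 -scalerBr => /eqP/tf[E|/eqP].
  by rewrite E eqxx in a0.
by rewrite subr_eq0 => /eqP.
Qed.

(** The inverse fractional ideal is I' / c. *)
Definition invertible I := exists I' c,
  [/\ ideal I', c != 0 & smul I (I' : set A^o) = principal c].

Section Invertible.
Variables (V : lmodType A) (I : set A).
Hypotheses (tfV : torsion_free V) (invI : invertible I).

(** Multiplying I v within I M by I' gives c v in c M, and c cancels. *)
Lemma smul_cancel (M : set V) v : submodule M ->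
  (forall a, I a -> smul I M (a *: v)) -> M v.
Proof.
move=> sM h; have [I' [c [iI' c0 II']]] := invI.
have scM := scale_submod c sM.
have key : smul I (I' : set A^o) `<=` [set r | [set c *: m | m in M] (r *: v)].
  apply: smul_sub; first exact: preim_scale_ideal.
  move=> a a' Ia I'a' /=; rewrite [a *: a']mulrC -scalerA.
  suff sub : smul I M `<=` [set w | [set c *: m | m in M] (a' *: w)].
    by apply: sub; exact: h.
  apply: smul_sub; first exact: preim_scale_submod.
  move=> x m Ix Mm /=; rewrite scalerA mulrC.
  have [r _ <-] : principal c (x * a') by rewrite -II'; exact: (@smulZ A^o).
  by rewrite mulrC; exists (r *: m); [exact: submodZ | rewrite scalerA].
have [|m Mm /(torsion_free_inj tfV c0) <- //] := key c.
by rewrite II'; exact: principal_id.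
Qed.

(** To contain is to divide. For m in M and x' in I', x' m = c v with v in the colon, because I' I =
    (c); so c m, a combination of the x x' m, lies in c I (M : I). *)
Lemma smul_colon (M : set V) : submodule M -> M `<=` smul I setT ->
  smul I (colon I M) = M.
Proof.
move=> sM MI; apply/seteqP; split=> [|m Mm].
  by apply: smul_sub => // a u Ia; exact.
have [I' [c [iI' c0 II']]] := invI.
have key : smul I (I' : set A^o) `<=`
    [set r | [set c *: w | w in smul I (colon I M)] (r *: m)].
  apply: smul_sub; first by apply/preim_scale_ideal/scale_submod/smul_submod.
  move=> x x' Ix I'x' /=; rewrite -scalerA.
  have [v _ cv] : [set c *: w | w in [set: V]] (x' *: m).
    suff sub : smul I setT `<=` [set u | [set c *: w | w in [set: V]] (x' *: u)].
      by apply: sub; exact: MI.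
    apply: smul_sub; first exact/preim_scale_submod/scale_submod/submodule_setT.
    move=> a u Ia _ /=; rewrite scalerA mulrC.
    have [r _ <-] : principal c (a * x') by rewrite -II'; exact: (@smulZ A^o).
    by rewrite mulrC; exists (r *: u) => //; rewrite scalerA.
  exists (x *: v); last by rewrite -cv !scalerA mulrC.
  apply: smulZ => // a Ia.
  have [r _ ar] : principal c (a * x') by rewrite -II'; exact: (@smulZ A^o).
  suff -> : a *: v = r *: m by exact: submodZ.
  apply: (torsion_free_inj tfV c0).
  by rewrite scalerA (mulrC c a) -scalerA cv !scalerA -ar mulrC.
have [|w hw /(torsion_free_inj tfV c0) <- //] := key c.
by rewrite II'; exact: principal_id.
Qed.

End Invertible.

End IdealProduct.

Definition finite_quotients (A : comNzRingType) :=
  forall a : A, a != 0 -> fin_index (principal a : set A^o).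

(* If b / a stabilises the nonzero ideal generated by the c i, then it belongs
   to A: for a domain this is integral closedness, by the determinant trick. *)
Definition integrally_closed (A : comNzRingType) :=
  forall n (c : 'I_n -> A) (a b : A), a != 0 -> (exists i, c i != 0) ->
  (forall i, exists t : 'I_n -> A, b * c i = a * \sum_j t j * c j) ->
  principal a b.

(** What remains of the rank over the integers: it bounds the number of maximal ideals of a given
    residue characteristic. *)
Definition finite_rank (A : comNzRingType) :=
  exists d, forall m, (0 < m)%N ->
  fin_index (principal m%:R : set A^o) /\
  (module_index (principal (m%:R : A) : set A^o) <= m ^ d)%N.

Section Dedekind.
Variable A : comNzRingType.
Implicit Types (I J : set A) (a b x y : A).

Hypothesis domA : torsion_free (A^o : lmodType A).
Hypothesis finA : finite_quotients A.
Hypothesis intA : integrally_closed A.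

Lemma mul_eq0 a b : a * b = 0 -> a = 0 \/ b = 0.
Proof. exact: domA. Qed.

Lemma mul_neq0 a b : a != 0 -> b != 0 -> a * b != 0.
Proof. by move=> a0 b0; apply/eqP => /mul_eq0[]/eqP; rewrite (negbTE a0, negbTE b0). Qed.

Lemma mul_inj c x y : c != 0 -> c * x = c * y -> x = y.
Proof. exact: (@torsion_free_inj _ A^o). Qed.

Lemma nonzero_idealP I : nonzero_ideals I <-> ideal I /\ exists2 a, I a & a != 0.
Proof.
split=> [[iI I0]|[iI [a Ia a0]]]; split=> //.
  apply: contrapT => h; apply: I0; apply/seteqP; split=> x /=; last first.
    by move=> ->; exact: ideal0.
  by move=> Ix; apply: contrapT => /eqP x0; apply: h; exists x.
by move=> I0; move: Ia; rewrite I0 /= => /eqP; rewrite (negbTE a0).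
Qed.

Lemma nonzero_ideal_fin I : nonzero_ideals I -> fin_index (I : set A^o).
Proof.
move=> /nonzero_idealP[iI [a Ia a0]].
have [|//] := @fin_indexS _ A^o (principal a) I (ideal_principal a) iI _ (finA a0).
exact: principal_sub.
Qed.

Lemma ideal_reps I J : ideal I -> ideal J -> J `<=` I -> fin_index (J : set A^o) ->
  exists s : seq A, (forall z, z \in s -> I z) /\
    forall x, I x -> exists2 z, z \in s & J (x - z).
Proof.
move=> iI iJ JI /(fin_index_classifies iJ)[phi [/choice[rho rhoK] phiP]].
exists [seq rho u | u <- enum 'I_(module_index (J : set A^o)) & `[< I (rho u) >]].
split=> [z /mapP[u]|x Ix]; first by rewrite mem_filter => /andP[/asboolP + _] ->.
have Jx : J (x - rho (phi x)) by apply/phiP; rewrite rhoK.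
exists (rho (phi x)) => //; apply/mapP; exists (phi x) => //.
rewrite mem_filter mem_enum andbT; apply/asboolP.
by apply: (iffLR (ideal_congr iI _)) Ix; exact: JI.
Qed.

(** A covering idempotent e for representatives of I modulo a lies in I, so 1 - e is nonzero modulo
    a, while every representative is nilpotent on the component of 1 - e. That component contains a
    nonzero element killed by all of them. *)
Lemma ideal_annihilator I a : ideal I -> ~ I 1 -> I a -> a != 0 ->
  exists2 b, ~ principal a b & forall x, I x -> principal a (b * x).
Proof.
move=> iI I1 Ia a0; have iJ := ideal_principal a; set J := principal a in iJ *.
have JI : J `<=` I by exact: principal_sub.
have [s [sI sP]] := ideal_reps iI iJ JI (finA a0).
have pJ := fin_index_pi_regular iJ (finA a0).
pose Phi : set (A^o -> A) := [set f | exists r : A, forall x, f x = r * x].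
have [|||z /sI Iz|e [ee [m [f [Im [r fr]] fe]] es]] := @idempotent_cover _ A^o I J Phi iI iJ pJ _ _ _ s.
- move=> g c u v [q gq] _ _; rewrite !gq mulrDr; congr (_ + _).
  exact: mulrCA.
- by exists 0 => x; rewrite mul0r.
- move=> g h c d [q gq] [q' hq']; exists (c * q + d * q') => x.
  by rewrite gq hq' !mulrA mulrDl.
- by exists ( *%R 1), z; split=> //; [exists 1|rewrite mul1r].
have Ie : I e.
  apply: (iffLR (ideal_congr iI (JI _ fe))).
  by rewrite fr; exact: idealM.
have Je : ~ J (1 - e).
  by move=> /JI h; apply: I1; rewrite -(subrK e 1); exact: idealD.
have [r0 [Jb bs]] : exists r0, ~ J ((1 - e) * r0) /\
    forall z, z \in s -> J ((1 - e) * r0 * z).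
  move: (1 - e) Je es {sI sP}; elim: s => [b Jb _|z s ih b Jb es].
    by exists 1; rewrite mulr1.
  have ex : exists k, `[< J (b * z ^+ k) >].
    by have [k /asboolP hk] := es z (mem_head _ _); exists k.
  (* The last power of z that keeps the product outside J gives an element that z kills. *)
  case: (ex_minnP ex) => -[|k] /asboolP hk kmin; first by rewrite expr0 mulr1 in hk.
  have [|w ws|r0 [Jr0 r0s]] := ih (b * z ^+ k).
  - by move=> /asboolP/kmin; rewrite ltnn.
  - have [|l hl] := es w; first by rewrite inE ws orbT.
    by exists l; rewrite mulrAC; exact: idealMr.
  exists (z ^+ k * r0); rewrite mulrA; split=> // w.
  rewrite inE => /orP[/eqP ->|]; last exact: r0s.
  by rewrite -mulrA (mulrC r0) mulrA -(mulrA b) -exprSr; exact: idealMr.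
exists ((1 - e) * r0) => // x /sP[z zs Jxz].
rewrite -(subrK z x) mulrDr; apply: idealD => //; last exact: bs.
exact: idealM.
Qed.

Lemma ideal_stable I a b : nonzero_ideals I -> a != 0 ->
  (forall x, I x -> exists2 y, I y & b * x = a * y) -> principal a b.
Proof.
move=> /nonzero_idealP[iI [a0 Ia0 a00]] an0 H.
have [|s [sI sP]] := ideal_reps iI (ideal_principal a0) _ (finA a00).
  exact: principal_sub.
pose c (i : 'I_(size s).+1) := nth 0 (a0 :: s) i.
have Ic i : I (c i).
  have := mem_nth 0 (ltn_ord i : (i < size (a0 :: s))%N); rewrite inE /c.
  by case/orP => [/eqP ->|/sI].
apply: (@intA _ c _ _ an0); first by exists ord0.
move=> i; have [y Iy ->] := H _ (Ic i).
have [z /(nthP 0)[k ks kz] [r _ yz]] := sP y Iy.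
pose i1 := lift ord0 (Ordinal ks).
exists (fun j => (j == ord0)%:R * r + (j == i1)%:R).
rewrite (bigD1 ord0) //= (bigD1 i1) //= big1 => [|j /andP[j0 j1]]; last first.
  by rewrite (negbTE j0) (negbTE j1) mul0r addr0 mul0r.
have -> : c i1 = z by rewrite /c lift0 /= kz.
by rewrite !eqxx mul1r !mul0r add0r mul1r !addr0 /c /= yz subrK.
Qed.

(* An annihilator b of I modulo a in I gives the strictly larger ideal
   I + (b / a) I, whose inverse yields one for I: induction on the index. *)
Lemma nonzero_invertible I : nonzero_ideals I -> invertible I.
Proof.
have [n] := ubnP (module_index (I : set A^o)).
elim: n I => // n ih I In nzI; have /nonzero_idealP[iI [a Ia a0]] := nzI.
case: (pselect (I 1)) => [I1|I1].
  exists setT, 1; rewrite oner_eq0; split=> //.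
    by apply/idealP; split.
  apply/seteqP; split=> x _; first by exists x; rewrite ?mulr1.
  by rewrite -[x]mul1r; apply: (@smulZ _ A^o).
have [b ab bI] := ideal_annihilator iI I1 Ia a0.
pose I1' := [set z | exists x y, [/\ I x, I y & a * z = a * x + b * y]].
have iI1 : ideal I1'.
  apply/idealP; split=> [|z w [x [y [Ix Iy E]]] [x' [y' [Ix' Iy' E']]]|c z [x [y [Ix Iy E]]]].
  - by exists 0, 0; rewrite !mulr0 addr0; split=> //; exact: ideal0.
  - exists (x + x'), (y + y'); split; [exact: idealD|exact: idealD|].
    by rewrite !mulrDr E E'; ring.
  - exists (c * x), (c * y); split; [exact: idealM|exact: idealM|].
    by rewrite mulrCA E; ring.
have II1 : I `<=` I1'.
  by move=> x Ix; exists x, 0; split=> //; [exact: ideal0|rewrite mulr0 addr0].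
have nzI1 : nonzero_ideals I1' by apply/nonzero_idealP; split=> //; exists a => //; exact: II1.
have [_ [leI]] := @fin_indexS _ A^o I I1' iI iI1 II1 (nonzero_ideal_fin nzI).
(* Otherwise b / a would stabilise I, and integral closedness would put b in (a). *)
have nI1I : ~ (I1' `<=` I).
  move=> sub; apply: ab; apply: (ideal_stable nzI a0) => x Ix.
  have [z _ az] := bI x Ix; exists z; last by rewrite -az mulrC.
  by apply: sub; exists 0, x; split=> //; [exact: ideal0|rewrite -az mulrC mulr0 add0r].
rewrite asboolF // => /eqP neI.
have [|J [c [iJ c0 IJ]]] := ih I1' _ nzI1.
  rewrite -ltnS; apply: leq_ltn_trans In; rewrite ltn_neqAle leI andbT.
  by apply/eqP.
(* If I1 J = (c), then I (a J + b J) = a I1 J = (a c). *)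
exists [set w | exists x y, [/\ J x, J y & w = a * x + b * y]], (a * c).
split; last 1 first.
- apply/seteqP; split=> [|_ [r _ <-]].
    apply: smul_sub; first exact: ideal_principal.
    move=> x _ Ix [x' [y' [Jx' Jy' ->]]].
    have [z _ az] := bI x Ix.
    have I1z : I1' z by exists 0, x; split=> //; [exact: ideal0|rewrite -az mulrC mulr0 add0r].
    have Pc u v : I1' u -> J v -> principal c (u * v).
      by move=> Iu Jv; rewrite -IJ; exact: (@smulZ _ A^o).
    have [r _ rE] := Pc x x' (II1 _ Ix) Jx'; have [t _ tE] := Pc z y' I1z Jy'.
    exists (r + t) => //.
    have -> : (r + t) * (a * c) = a * (r * c) + a * (t * c) by ring.
    rewrite rE tE.
    rewrite -[RHS]/(x * (a * x' + b * y')).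
    have -> : x * (a * x' + b * y') = a * (x * x') + (b * x) * y' by ring.
    by rewrite -az; ring.
  set S := smul _ _; have sS : ideal S by exact: smul_submod.
  have sub : smul I1' (J : set A^o) `<=` [set w | S (a * w)].
    apply: smul_sub.
      exact: (@preim_scale_submod _ A^o S a sS).
    move=> z y [x [x2 [Ix Ix2 E]]] Jy /=.
    rewrite -[z *: _]/(z * y) mulrA E.
    have -> : (a * x + b * x2) * y = x * (a * y) + x2 * (b * y) by ring.
    apply: (idealD sS); apply: (@smulZ _ A^o) => //.
      by exists y, 0; split=> //; [exact: ideal0|rewrite mulr0 addr0].
    by exists 0, y; split=> //; [exact: ideal0|rewrite mulr0 add0r].
  by apply: (idealM r sS); apply: sub; rewrite IJ; exact: principal_id.
- apply/idealP; split=> [|z w [x [y [Ix Iy ->]]] [x' [y' [Ix' Iy' ->]]]|d z [x [y [Ix Iy ->]]]].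
  - by exists 0, 0; rewrite !mulr0 addr0; split=> //; exact: ideal0.
  - exists (x + x'), (y + y'); split; [exact: idealD|exact: idealD|ring].
  - exists (d * x), (d * y); split; [exact: idealM|exact: idealM|ring].
- exact: mul_neq0.
Qed.

(* An ideal is generated by one element modulo any multiple of itself; the
   generator is found where some functional I -> A takes the value 1 mod J. *)
Lemma generator_mod I J : nonzero_ideals I -> nonzero_ideals J ->
  exists2 a, I a & forall x, I x -> exists r, smul I (J : set A^o) (x - r * a).
Proof.
move=> nzI nzJ; have [iI _] := nzI; have [iJ _] := nzJ.
have finJ := nonzero_ideal_fin nzJ.
have pJ := fin_index_pi_regular iJ finJ.
pose Phi : set (A^o -> A) := [set f | forall a (u v : A^o), I u -> I v ->
  f (a *: u + v) = a * f u + f v].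
have [||||a [f [Ia Pf fa]]] := @stable_range _ A^o I J Phi iI iJ pJ.
- by move=> f a u v; exact.
- by move=> a u v _ _ /=; rewrite mulr0 addr0.
- move=> f g c d hf hg a u v Iu Iv.
  by rewrite hf // hg //; ring.
(* For y in I', the map x |-> x y / c is a functional on I, and the products x y generate (c): the
   values generate 1. *)
- move=> P iP hP; have [I' [c [iI' c0 II']]] := nonzero_invertible nzI.
  have sub : smul I (I' : set A^o) `<=` [set w | exists2 z, w = c * z & P z].
    apply: smul_sub; first apply/idealP; first split=> [|x y [z -> Pz] [w -> Pw]|b x [z -> Pz]].
    - by exists 0; [rewrite mulr0|exact: ideal0].
    - by exists (z + w); [rewrite mulrDr|exact: idealD].
    - by exists (b * z); [rewrite mulrCA|exact: idealM].
    move=> x y Ix I'y.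
    have /choice[f fP] : forall x, exists z, I x -> x * y = c * z.
      move=> u; case: (pselect (I u)) => [Iu|]; last by exists 0.
      have : principal c (u * y) by rewrite -II'; exact: (@smulZ _ A^o).
      by case=> r _ rE; exists r => _; rewrite -rE mulrC.
    exists (f x); first exact: fP.
    apply: hP => // a u v Iu Iv; apply: (mul_inj c0).
    rewrite -fP; last by apply: idealD => //; exact: idealM.
    by rewrite mulrDr mulrCA -!fP // mulrDl -mulrA.
  have [|z /eqP cz] := sub c; first by rewrite II'; exact: principal_id.
  by rewrite (mul_inj c0 (etrans (mulr1 c) (eqP cz))).
exists a => // x Ix; exists (f x).
(* Both sides are f (x a). Hence x - f(x) a = x (1 - f(a)) lies in I J. *)
have fxa : f x * a = x * f a.
  have := Pf a x 0 Ix (ideal0 iI); have := Pf x a 0 Ia (ideal0 iI).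
  have f0 : f 0 = 0.
    have /eqP := Pf 1 0 0 (ideal0 iI) (ideal0 iI).
    by rewrite scaler0 addr0 mul1r -subr_eq subrr eq_sym => /eqP.
  rewrite !addr0 f0 !addr0 => <-; rewrite mulrC => <-.
  by congr f; exact: mulrC.
have -> : x - f x * a = x *: ((1 - f a) : A^o).
  by rewrite fxa -[RHS]/(x * (1 - f a)) mulrBr mulr1.
by apply: smulZ => //; apply: ideal_subr.
Qed.

(* With I = a A + I J, multiplication by a induces V / M -> I V / I M. *)
Lemma module_index_smul (V : lmodType A) I (M : set V) r :
  torsion_free V -> nonzero_ideals I -> submodule M -> fin_index M ->
  fin_index (smul I [set: V]) -> r != 0 -> (forall v, M (r *: v)) ->
  fin_index (smul I M) /\
  module_index (smul I M) = (module_index (smul I [set: V]) * module_index M)%N.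
Proof.
move=> tfV nzI sM finM finI r0 rM; have [iI _] := nzI.
have invI := nonzero_invertible nzI.
have nzr : nonzero_ideals (principal r).
  by apply/nonzero_idealP; split; [exact: ideal_principal|exists r => //; exact: principal_id].
(* As r kills V / M, the module I (r) V lies in I M, so I V = a V + I M. *)
have [a Ia aP] := generator_mod nzI nzr.
have IJM y v : smul I (principal r : set A^o) y -> smul I M (y *: v).
  move: y; apply: (@smul_sub _ A^o _ _ [set y | smul I M (y *: v)]).
    exact/preim_scale_ideal/smul_submod.
  move=> x _ Ix [t _ <-] /=; rewrite -[x *: _]/(x * (t * r)) -scalerA.
  by apply: smulZ => //; rewrite -scalerA; exact: submodZ.
apply: (@module_index_tower _ V V (smul I M) (smul I setT) M (fun v => a *: v)).
- exact: smul_submod.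
- exact: smul_submod.
- by [].
- exact: smulS.
- by move=> w; exact: smulZ.
- apply: (@smul_sub _ V I setT [set n | exists w, smul I M (n - a *: w)]).
    apply: submodI => [|u v [w hw] [w' hw']|b u [w hw]].
    - by exists 0; rewrite scaler0 subr0; exact: submod0 (smul_submod _ _).
    - exists (w + w'); rewrite scalerDr opprD addrACA.
      exact: submodD (smul_submod _ _) hw hw'.
    - exists (b *: w); rewrite scalerA (mulrC a) -scalerA -scalerBr.
      exact: submodZ (smul_submod _ _) hw.
  move=> x v Ix _; have [s hs] := aP x Ix; exists (s *: v).
  by rewrite scalerA (mulrC a) -scalerBl; exact: IJM.
- move=> w w'; rewrite -scalerBr; split=> [h|]; last exact: smulZ.
  apply: (smul_cancel tfV invI sM) => x Ix; have [s hs] := aP x Ix.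
  rewrite -(subrK (s * a) x) scalerDl; apply: (submodD (smul_submod _ _)).
    exact: IJM.
  by rewrite -scalerA; apply: (submodZ _ (smul_submod _ _)).
- by [].
- by [].
Qed.

Lemma smul_setT I : ideal I -> smul I [set: A^o] = I.
Proof.
move=> iI; apply/seteqP; split=> [|x Ix].
  by apply: smul_sub => // a u Ia _; exact: idealMr.
by rewrite -[x]mulr1; exact: (@smulZ _ A^o).
Qed.

Lemma nonzero_smul I J : nonzero_ideals I -> nonzero_ideals J ->
  nonzero_ideals (smul I (J : set A^o) : set A).
Proof.
move=> /nonzero_idealP[iI [a Ia a0]] /nonzero_idealP[iJ [b Jb b0]].
apply/nonzero_idealP; split; first exact: smul_submod.
by exists (a * b); [exact: (@smulZ _ A^o)|exact: mul_neq0].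
Qed.

Lemma ideal_norm_smul I J : nonzero_ideals I -> nonzero_ideals J ->
  ideal_norm (smul I (J : set A^o) : set A) = (ideal_norm I * ideal_norm J)%N.
Proof.
move=> nzI nzJ; have [iI _] := nzI; have /nonzero_idealP[iJ [b Jb b0]] := nzJ.
have [||_] := @module_index_smul A^o I J b domA nzI iJ (nonzero_ideal_fin nzJ) _ b0.
- by rewrite smul_setT //; exact: nonzero_ideal_fin.
- by move=> v; exact: idealMr.
- by rewrite smul_setT.
Qed.

End Dedekind.

(** * Submodules of A^2 *)

Section Free2.
Variable A : comNzRingType.
Implicit Types (I J : set A) (a b x y : A) (M : set (free2 A)).

Hypothesis domA : torsion_free (A^o : lmodType A).
Hypothesis finA : finite_quotients A.
Hypothesis intA : integrally_closed A.

Lemma torsion_free2 : torsion_free (free2 A).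
Proof.
move=> a [x y] [/domA ax /domA ay].
by case: ax ay => [->|->] []; [left|left|left|move=> ->; right].
Qed.

(** * Lattices fibred over pairs of ideals *)

Definition fst_ideal M : set A := [set x | M (x, 0)].
Definition snd_ideal M : set A := [set y | exists x, M (x, y)].

Lemma fst_ideal_ideal M : submodule M -> ideal (fst_ideal M).
Proof.
move=> sM; apply/idealP; split=> [|x y Mx My|a x Mx]; rewrite /fst_ideal /=.
- exact: submod0 sM.
- by have := submodD sM Mx My; rewrite -[_ + _]/(x + y, 0 + 0) addr0.
- by have := submodZ a sM Mx; rewrite -[_ *: _]/(a * x, a * 0) mulr0.
Qed.

Lemma snd_ideal_ideal M : submodule M -> ideal (snd_ideal M).
Proof.
move=> sM; apply/idealP; split=> [|y y' [x Mx] [x' My]|a y [x Mx]].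
- by exists 0; exact: submod0 sM.
- by exists (x + x'); exact: submodD sM Mx My.
- by exists (a * x); have := submodZ a sM Mx.
Qed.

Lemma cotorsion_nonzero M : cotorsion_submodules M ->
  nonzero_ideals (snd_ideal M) /\ nonzero_ideals (fst_ideal M).
Proof.
move=> [sM tM]; have [r r0 Mr] := tM (1, 0); have [s s0 Ms] := tM (0, 1).
split; apply/nonzero_idealP; split.
- exact: snd_ideal_ideal.
- exists s => //; exists 0; move: Ms.
  by rewrite -[_ *: _]/(s * 0, s * 1) mulr0 mulr1.
- exact: fst_ideal_ideal.
- exists r => //; move: Mr.
  by rewrite -[_ *: _]/(r * 1, r * 0) mulr0 mulr1.
Qed.

Lemma cotorsion_index M : cotorsion_submodules M -> fin_index M /\
  module_index M = (ideal_norm (snd_ideal M) * ideal_norm (fst_ideal M))%N.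
Proof.
move=> coM; have [sM _] := coM; have [nzI nzJ] := cotorsion_nonzero coM.
have [iI _] := nzI; have [iJ _] := nzJ; have finI := nonzero_ideal_fin finA nzI.
pose N : set (free2 A) := setT `*` snd_ideal M.
have sN : submodule N.
  apply: submodI; first by split=> //; exact: ideal0.
    by move=> u v [_ hu] [_ hv]; split=> //; exact: idealD.
  by move=> r u [_ hu]; split=> //; exact: idealM.
have [oneT finT] := @module_index_setT A A^o.
have [finN EN] := @module_indexX A A^o A^o setT (snd_ideal M)
   (submodule_setT _) iI finT finI.
have [] := @module_index_tower A (free2 A) A^o M N (fst_ideal M)
  (fun x => (x, 0)) sM sN iJ; last by rewrite EN oneT mul1n.
- by move=> [x y] Mxy; split=> //; exists x.
- by move=> w; split=> //; exact: ideal0.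
- move=> [x y] [_ [x' /= Mx']]; exists (x - x').
  by rewrite -[_ - _]/(x - (x - x'), y - 0) subr0 opprB addrC subrK.
- by move=> w w'; rewrite -[_ - _]/(w - w', 0 - 0) subr0.
- exact: finN.
- exact: nonzero_ideal_fin.
Qed.

Section Fiber.
Variables I J : set A.
Hypotheses (nzI : nonzero_ideals I) (nzJ : nonzero_ideals J).

Let IJ := smul I (J : set A^o).
Let sIJ : ideal IJ. Proof. exact: smul_submod. Qed.

Let iI : ideal I. Proof. by case: nzI. Qed.
Let iJ : ideal J. Proof. by case: nzJ. Qed.

(* The submodule attached to the homomorphism I -> A / J mapping a to c. *)
Let lattice a c : set (free2 A) :=
  [set v | exists r, IJ (v.2 - r * a) /\ J (v.1 - r * c)].

Let IJI : IJ `<=` I.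
Proof. by apply: (smul_sub iI) => i j Ii _; exact: idealMr. Qed.

Lemma fiber_card :
  let F := @cotorsion_submodules A `&`
    (fun M => (snd_ideal M, fst_ideal M)) @^-1` [set (I, J)] in
  finite_set F /\ set_card F = ideal_norm J.
Proof.
move=> F; have [a Ia aP] := generator_mod domA finA intA nzI nzJ.
(* Since I = a A + I J, r a in I J forces r I within I J, and I cancels: a generates I / I J freely
   over A / J. *)
have areg r : IJ (r * a) -> J r.
  move=> h; apply: (@smul_cancel A A^o I domA _ J r iJ).
    exact: (nonzero_invertible domA finA intA).
  move=> x Ix; have [s hs] := aP x Ix.
  rewrite -[x *: _]/(x * r) -[x](subrK (s * a)) mulrDl.
  apply: (idealD sIJ); first exact: (idealMr _ sIJ).
  by rewrite -mulrA (mulrC a); exact: (idealM _ sIJ).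
have slat c : submodule (lattice a c).
  apply: submodI => [|u v [r [r1 r2]] [s [s1 s2]]|b u [r [r1 r2]]].
  - by exists 0; rewrite !mul0r !subr0; split; exact: ideal0.
  - exists (r + s); split; [have := idealD sIJ r1 s1|have := idealD iJ r2 s2];
      by rewrite addrACA -opprD -mulrDl.
  - exists (b * r); rewrite -!mulrA -[(b *: u).1]/(b * u.1) -[(b *: u).2]/(b * u.2).
    by rewrite -!mulrBr; split; [exact: (idealM _ sIJ)|exact: idealM].
have latF c : F (lattice a c).
  split; last first.
    congr pair; apply/seteqP; split.
    - move=> y [x [r [r1 _]]]; rewrite -[y](subrK (r * a)); apply: idealD => //.
        exact: IJI.
      exact: idealM.
    - move=> y Iy; have [r hr] := aP y Iy; exists (r * c), r; split=> //=.
      by rewrite subrr; exact: ideal0.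
    - move=> x [r [/= r1 r2]].
      move: r1 r2; rewrite sub0r => /(idealN sIJ); rewrite opprK => /areg Jr.
      by move=> h; rewrite -[x](subrK (r * c)); apply: idealD => //; exact: idealMr.
    - by move=> x Jx; exists 0; rewrite !mul0r !subr0; split=> //; exact: ideal0.
  split=> // v; have /nonzero_idealP[_ [j Jj j0]] := nzJ.
  have /nonzero_idealP[_ [i Ii i0]] := nzI.
  exists (i * j); first exact: mul_neq0.
  exists 0; rewrite !mul0r !subr0 -[(_ *: v).1]/(i * j * v.1) -[(_ *: v).2]/(i * j * v.2).
  split; last by apply: idealMr => //; exact: idealM.
  by apply: (idealMr _ sIJ); exact: (@smulZ _ A^o).
have [phi [/choice[rho rhoK] phiP]] := fin_index_classifies iJ (nonzero_ideal_fin finA nzJ).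
rewrite -[ideal_norm J]card_ord.
apply: (@set_card_range _ _ (fun u => lattice a (rho u))) => [u u' E|].
  (* This vector tells the lattices apart: its second coordinate forces the multiplier r to be 1
     modulo J. *)
  have : lattice a (rho u) (rho u, a).
    by exists 1; rewrite !mul1r !subrr; split; exact: ideal0.
  rewrite E => -[r [/= r1 r2]].
  rewrite -(rhoK u) -(rhoK u'); apply/phiP.
  have : J (1 - r) by apply: areg; rewrite mulrBl mul1r.
  move=> /(idealMr (rho u') iJ) /(idealB iJ r2).
  by congr J; ring.
apply/seteqP; split=> [_ [u _ <-]|M [[sM tM] /= [EI EJ]]]; first exact: latF.
have [c Mc] : snd_ideal M a by rewrite EI.
exists (phi c) => //.
have Jc : J (c - rho (phi c)) by apply/phiP; rewrite rhoK.
have MJ x : J x -> M (x, 0) by rewrite -EJ.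
have M' : M (rho (phi c), a).
  have := submodB sM Mc (MJ _ Jc).
  by rewrite -[_ - _]/(c - (c - rho (phi c)), a - 0) subr0 opprB addrC subrK.
(* If (x, i) is in M and j in J, then (0, i j) = j (x, i) - (j x, 0). *)
have MIJ z : IJ z -> M (0, z).
  suff sub : IJ `<=` [set z | M (0, z)] by move/sub.
  apply: smul_sub.
    apply: submodI => /= [|x y hx hy|b x hx]; first exact: submod0 sM.
      by have := submodD sM hx hy; rewrite -[_ + _]/(0 + 0, x + y) addr0.
    by have := submodZ b sM hx; rewrite -[_ *: _]/(b * 0, b * x) mulr0.
  move=> i j; rewrite -{1}EI => -[x Mx] Jj /=.
  have := submodB sM (submodZ j sM Mx) (MJ (j * x) (idealMr _ iJ Jj)).
  by rewrite -[_ - _]/(j * x - j * x, j * i - 0) subrr subr0 mulrC.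
apply/seteqP; split=> [[x y] [r [/= r1 r2]]|[x y] Mxy].
  have := submodD sM (submodD sM (MIJ _ r1) (MJ _ r2)) (submodZ r sM M').
  rewrite -[_ + _ + _]/(0 + (x - r * rho (phi c)) + r * rho (phi c), y - r * a + 0 + r * a).
  by congr M; congr pair; ring.
have Iy : I y by rewrite -EI; exists x.
have [r hr] := aP y Iy; exists r; split=> //=.
rewrite -EJ /fst_ideal /=.
have := submodB sM (submodB sM Mxy (MIJ _ hr)) (submodZ r sM M').
rewrite -[_ - _ - _]/(x - 0 - r * rho (phi c), y - (y - r * a) - r * a).
by congr M; congr pair; ring.
Qed.

End Fiber.

(** * Content and primitive lattices *)

Definition content M : set A := [set z | exists v w, [/\ M v, M w & z = v.1 + w.2]].

Definition primitive : set (set (free2 A)) :=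
  [set M | cotorsion_submodules M /\ content M = setT].

(** The two coordinate projections of M are ideals, so one summand from each reaches the whole ideal
    generated by the coordinates. *)
Lemma content_ideal M : submodule M -> ideal (content M).
Proof.
move=> sM; apply/idealP; split=>
  [|x y [v [w [Mv Mw ->]]] [v' [w' [Mv' Mw' ->]]]|a x [v [w [Mv Mw ->]]]].
- by exists 0, 0; rewrite addr0; split=> //; exact: submod0 sM.
- exists (v + v'), (w + w'); split; [exact: submodD|exact: submodD|].
  by rewrite addrACA.
- exists (a *: v), (a *: w); split; [exact: submodZ|exact: submodZ|].
  by rewrite mulrDr.
Qed.

Lemma smul_free2 I : ideal I -> smul I [set: free2 A] = I `*` I.
Proof.
move=> iI; apply/seteqP; split=> [|[x y] [/= Ix Iy]].
  apply: smul_sub => [|a u Ia _]; last by split; exact: idealMr.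
  apply: submodI => [|u v [u1 u2] [v1 v2]|a u [u1 u2]]; split;
    [exact: ideal0|exact: ideal0|exact: idealD|exact: idealD|exact: idealM|exact: idealM].
have -> : (x, y) = x *: ((1, 0) : free2 A) + y *: ((0, 1) : free2 A).
  by rewrite -[RHS]/(x * 1 + y * 0, x * 0 + y * 1) !mulr0 !mulr1 addr0 add0r.
by apply: (submodD (smul_submod _ _)); exact: smulZ.
Qed.

Lemma sub_content M : submodule M -> M `<=` content M `*` content M.
Proof.
move=> sM v Mv; split=> /=.
  by exists v, 0; split=> //; [exact: submod0|rewrite addr0].
by exists 0, v; split=> //; [exact: submod0|rewrite add0r].
Qed.

Lemma content_nonzero M : cotorsion_submodules M -> nonzero_ideals (content M).
Proof.
move=> [sM tM]; apply/nonzero_idealP; split; first exact: content_ideal.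
have [r r0 Mr] := tM (1, 0); exists r => //.
have [h _] := sub_content sM Mr.
by rewrite -[r]mulr1; exact: h.
Qed.

Lemma cotorsion_scalar M : cotorsion_submodules M ->
  exists2 r, r != 0 & forall v, M (r *: v).
Proof.
move=> [sM tM]; have [r r0 Mr] := tM (1, 0); have [s s0 Ms] := tM (0, 1).
exists (r * s) => [|[x y]]; first exact: mul_neq0.
have := submodD sM (submodZ (s * x) sM Mr) (submodZ (r * y) sM Ms).
rewrite -[_ + _]/(s * x * (r * 1) + r * y * (s * 0), s * x * (r * 0) + r * y * (s * 1)).
rewrite -[(r * s) *: _]/(r * s * x, r * s * y).
by congr M; congr pair; ring.
Qed.

Section Content.
Variable I : set A.
Hypothesis nzI : nonzero_ideals I.
Let iI : ideal I. Proof. by case: nzI. Qed.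
Let invI : invertible I. Proof. exact: nonzero_invertible. Qed.

Lemma smul_cotorsion M : cotorsion_submodules M -> cotorsion_submodules (smul I M).
Proof.
move=> [sM tM]; split=> [|v]; first exact: smul_submod.
have [r r0 Mr] := tM v; have /nonzero_idealP[_ [i Ii i0]] := nzI.
by exists (i * r); [exact: mul_neq0|rewrite -scalerA; exact: smulZ].
Qed.

(** A lattice M of content I is I (M : I). This colon is primitive: I times its content contains the
    coordinates of M, which generate I, and I cancels. *)
Lemma smul_primitive_fiber : (@smul A (free2 A) I) @` primitive =
  @cotorsion_submodules A `&` content @^-1` [set I].
Proof.
apply/seteqP; split=> [_ [M [coM cM] <-]|M [coM /= cM]].
  have [sM _] := coM; split; first exact: smul_cotorsion.
  apply/seteqP; split=> [_ [v [w [hv hw ->]]]|z Iz].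
    have sub : smul I M `<=` I `*` I by rewrite -smul_free2 //; exact: smulS.
    by apply: idealD => //; [have [] := sub _ hv|have [] := sub _ hw].
  have [v [w [Mv Mw E]]] : content M 1 by rewrite cM.
  exists (z *: v), (z *: w); split; [exact: smulZ|exact: smulZ|].
  by rewrite -[_ + _]/(z * v.1 + z * w.2) -mulrDr -E mulr1.
have [sM tM] := coM.
have MI : M `<=` smul I setT.
  by rewrite smul_free2 //; have := sub_content sM; rewrite cM.
have scol := colon_submod I sM.
exists (colon I M); last exact: (smul_colon torsion_free2).
split.
  split=> // v; have [r r0 Mr] := tM v; exists r => // a Ia; exact: submodZ.
apply: ideal_setT; first exact: content_ideal.
apply: (@smul_cancel A A^o I domA invI _ (1 : A)); first exact: content_ideal.
move=> a; rewrite -{1}cM => -[v [w [Mv Mw ->]]].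
rewrite -[_ *: _]/((v.1 + w.2) * 1) mulr1.
have sub : smul I (colon I M) `<=`
   [set u | smul I (content (colon I M) : set A^o) u.1 /\
            smul I (content (colon I M) : set A^o) u.2].
  apply: smul_sub => [|b u Ib cu /=].
    apply: submodI => [|u u' [u1 u2] [u'1 u'2]|b u [u1 u2]].
    - by split; exact: (submod0 (smul_submod _ _)).
    - by split; exact: (submodD (smul_submod _ _)).
    - by split; exact: (submodZ _ (smul_submod _ _)).
  by have [c1 c2] := sub_content scol cu; split; exact: (@smulZ _ A^o).
rewrite -(smul_colon torsion_free2 invI sM MI) in Mv Mw.
have [v1 _] := sub _ Mv; have [_ w2] := sub _ Mw.
exact: (submodD (smul_submod _ _)).
Qed.

Lemma smul_primitive_inj : set_inj primitive (@smul A (free2 A) I).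
Proof.
have key M M' : submodule M' -> smul I M = smul I M' -> M `<=` M'.
  move=> sM' E v Mv; apply: (smul_cancel torsion_free2 invI sM') => a Ia.
  by rewrite -E; exact: smulZ.
move=> M M'; rewrite !inE => -[[sM _] _] [[sM' _] _] E.
by apply/seteqP; split; apply: key.
Qed.

Lemma module_index_smul2 M : cotorsion_submodules M ->
  module_index (smul I M) = (ideal_norm I * ideal_norm I * module_index M)%N.
Proof.
move=> coM; have [sM _] := coM; have [finM _] := cotorsion_index coM.
have [r r0 rM] := cotorsion_scalar coM.
have finI := nonzero_ideal_fin finA nzI.
have [fX eX] := @module_indexX A A^o A^o I I iI iI finI finI.
have [] := module_index_smul domA finA intA torsion_free2 nzI sM finM _ r0 rM.
  by rewrite smul_free2.
by move=> _ ->; rewrite smul_free2 // eX.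
Qed.

End Content.

(** * Unimodular vectors and the points of the projective line *)

Lemma unimodularP (v : A * A) :
  unimodular v <-> exists p q, p * v.1 + q * v.2 = 1.
Proof.
split=> [E|[p [q E]]].
  have : [set x + y | x in principal v.1 & y in principal v.2] 1.
    by rewrite [[set _ | _ in _ & _ in _]]E.
  by case=> _ [p _ <-] [_ [q _ <-] E1]; exists p, q.
apply/seteqP; split=> // x _; exists (x * p * v.1); first by exists (x * p).
exists (x * q * v.2); first by exists (x * q).
by rewrite -!mulrA -mulrDr E mulr1.
Qed.

(* With e the idempotent power of b modulo a, the element b + (1 - e) j is a
   unit modulo a both where b is and where b is nilpotent. *)
Lemma unimodular_lift a b j q : a != 0 -> principal a (1 - (q * b + j)) ->
  exists r, unimodular (a, b + r * j).
Proof.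
move=> a0 ha; have ia := ideal_principal a.
have [k hk] := fin_index_pi_regular ia (finA a0) b.
set e := b ^+ k.+1 in hk; exists (1 - e); apply/unimodularP => /=.
pose D : set A := [set x | exists p q, x = p * a + q * (b + (1 - e) * j)].
have iD : ideal D.
  apply/idealP; split=> [|_ _ [p [p' ->]] [r [r' ->]]|c _ [p [p' ->]]].
  - by exists 0, 0; ring.
  - by exists (p + r), (p' + r'); ring.
  - by exists (c * p), (c * p'); ring.
have aD : principal a `<=` D by move=> _ [r _ <-]; exists r, 0; ring.
have bD : D (b + (1 - e) * j) by exists 0, 1; ring.
have eeD : D (e * e - e) by exact: aD.
have ebD : D (e * b).
  have -> : e * b = e * (b + (1 - e) * j) + j * (e * e - e) by ring.
  by apply: idealD => //; exact: idealM.
have eD : D e.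
  have -> : e = b ^+ k * (e * b) - (e * e - e) by rewrite /e exprS; ring.
  by apply: idealB => //; exact: idealM.
(* So b is invertible modulo D, and so is its power e; as e lies in D, D is all of A. *)
have D1 : D (1 - (q - 1) * b).
  have -> : 1 - (q - 1) * b = (1 - (q * b + j)) + (b + (1 - e) * j) + j * e by ring.
  by apply: idealD => //; [apply: idealD => //; exact: aD|exact: idealM].
suff [p [q' E]] : D 1 by exists p, q'.
apply: (iffRL (ideal_congr iD _)) (idealM ((q - 1) ^+ k.+1) iD eD).
by rewrite -exprMn -[X in X - _](expr1n _ k.+1); exact: ideal_expB.
Qed.

(** The stable range of linear forms on M gives (a, b) in M with p a + q b = 1 modulo r, where r A^2
    lies in M. The vector is then corrected within r A^2. *)
Lemma primitive_unimodular M : primitive M -> exists2 v, M v & unimodular v.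
Proof.
move=> [coM cM]; have [sM _] := coM; have [r r0 rM] := cotorsion_scalar coM.
have ir := ideal_principal r.
pose Phi : set (free2 A -> A) := [set f | exists p q, forall v, f v = p * v.1 + q * v.2].
have [||||[a b] [f [Mv [p [q fE]] h]]] :=
  @stable_range A (free2 A) M (principal r) Phi sM ir
    (fin_index_pi_regular ir (finA r0)).
- move=> f c u v [p [q fE]] _ _; rewrite !fE.
  by rewrite -[(_ + _).1]/(c * u.1 + v.1) -[(_ + _).2]/(c * u.2 + v.2); ring.
- by exists 0, 0 => v; ring.
- move=> f g c d [p [q fE]] [p' [q' gE]]; exists (c * p + d * p'), (c * q + d * q') => v.
  by rewrite fE gE; ring.
- move=> P iP H.
  have [v [w [Mv Mw ->]]] : content M 1 by rewrite cM.
  apply: idealD => //.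
    apply: (H (fun v => v.1) v) => //.
    by exists 1, 0 => u; ring.
  apply: (H (fun v => v.2) w) => //.
  by exists 0, 1 => u; ring.
rewrite fE /= in h.
have MJ x y : principal r x -> principal r y -> M (x, y).
  move=> [x' _ <-] [y' _ <-]; have := rM (x', y').
  by rewrite -[_ *: _]/(r * x', r * y') ![r * _]mulrC.
(* [unimodular_lift] works modulo the first coordinate, so a zero one is replaced by r. *)
have [a' [a'0 Ma' ha']] : exists a',
    [/\ a' != 0, M (a', b) & principal r (1 - (p * a' + q * b))].
  have h1 := ideal_subr ir h.
  have [a0|a0] := eqVneq a 0; last by exists a.
  exists r; split=> //.
    have := submodD sM Mv (MJ r 0 (principal_id r) (ideal0 ir)).
    by rewrite -[_ + _]/(a + r, b + 0) a0 add0r addr0.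
  have -> : 1 - (p * r + q * b) = (1 - (p * a + q * b)) + (- p) * r by rewrite a0; ring.
  by apply: idealD => //; exists (- p).
(* The defect 1 - (p a' + q b) is a multiple of r, so adding multiples of it to b stays in M. *)
have [|s us] := @unimodular_lift a' b (1 - (p * a' + q * b)) q a'0.
  by exists p => //; ring.
exists (a', b + s * (1 - (p * a' + q * b))) => //.
have := submodD sM Ma' (MJ 0 _ (ideal0 ir) (idealM s ir ha')).
by rewrite -[_ + _]/(a' + 0, b + s * (1 - (p * a' + q * b))) addr0.
Qed.

(** For unimodular v this is A v + J A^2. *)
Definition vector_lattice (v : free2 A) J : set (free2 A) :=
  [set w | J (v.1 * w.2 - v.2 * w.1)].

Definition annihilator M : set A := [set r | forall v, M (r *: v)].

Lemma vector_lattice_submod v J : ideal J -> submodule (vector_lattice v J).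
Proof.
move=> iJ; apply: submodI => [|u w hu hw|a u hu].
- by rewrite /vector_lattice /= !mulr0 subrr; exact: ideal0.
- by have := idealD iJ hu hw; rewrite /vector_lattice /=; congr J; ring.
- have := idealM a iJ hu.
  change (J (a * (v.1 * u.2 - v.2 * u.1)) -> J (v.1 * (a * u.2) - v.2 * (a * u.1))).
  by congr J; ring.
Qed.

Lemma vector_lattice_id v J : ideal J -> vector_lattice v J v.
Proof. by move=> iJ; rewrite /vector_lattice /= mulrC subrr; exact: ideal0. Qed.

Lemma vector_lattice_annihilator v J : ideal J -> unimodular v ->
  annihilator (vector_lattice v J) = J.
Proof.
move=> iJ /unimodularP[p [q E]]; apply/seteqP; split=> [r hr|r Jr w].
  have h1 : J (v.1 * (r * 0) - v.2 * (r * 1)) := hr (1, 0).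
  have h2 : J (v.1 * (r * 1) - v.2 * (r * 0)) := hr (0, 1).
  have := idealD iJ (idealM p iJ h2) (idealM (- q) iJ h1); congr J.
  by transitivity (r * (p * v.1 + q * v.2)); [ring|rewrite E mulr1].
change (J (v.1 * (r * w.2) - v.2 * (r * w.1))).
have -> : v.1 * (r * w.2) - v.2 * (r * w.1) = r * (v.1 * w.2 - v.2 * w.1) by ring.
exact: idealMr.
Qed.

Lemma vector_lattice_primitive v J : nonzero_ideals J -> unimodular v ->
  primitive (vector_lattice v J).
Proof.
move=> /nonzero_idealP[iJ [j Jj j0]] uv; split.
  split=> [|w]; first exact: vector_lattice_submod.
  exists j => //.
  by have : annihilator (vector_lattice v J) j by rewrite vector_lattice_annihilator.
apply: ideal_setT; first by apply/content_ideal/vector_lattice_submod.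
have /unimodularP[p [q E]] := uv; have vl := vector_lattice_id v iJ.
exists (p *: v), (q *: v); split; last by rewrite -E.
- by apply: submodZ => //; exact: vector_lattice_submod.
- by apply: submodZ => //; exact: vector_lattice_submod.
Qed.

(** The determinant with v maps A^2 onto A because v is unimodular, hence A^2 modulo the lattice is
    A / J. *)
Lemma vector_lattice_index v J : nonzero_ideals J -> unimodular v ->
  module_index (vector_lattice v J) = ideal_norm J.
Proof.
move=> nzJ /unimodularP[p [q E]]; have [iJ _] := nzJ.
have [phi [phis phiP]] := fin_index_classifies iJ (nonzero_ideal_fin finA nzJ).
have [|_ ->] := @classifies_index A (free2 A) _
  (fun w => phi (v.1 * w.2 - v.2 * w.1)) (vector_lattice v J); last by rewrite card_ord.
split=> [u|w w'].
  have [x <-] := phis u; exists (- q * x, p * x) => /=; congr phi.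
  by rewrite -[RHS]mul1r -E; ring.
rewrite phiP; change (J (v.1 * w.2 - v.2 * w.1 - (v.1 * w'.2 - v.2 * w'.1)) <->
  J (v.1 * (w.2 - w'.2) - v.2 * (w.1 - w'.1))).
have -> // : v.1 * w.2 - v.2 * w.1 - (v.1 * w'.2 - v.2 * w'.1) =
  v.1 * (w.2 - w'.2) - v.2 * (w.1 - w'.1) by ring.
Qed.

(* M contains the kernel of w |-> v.1 w.2 - v.2 w.1, which is the line A v. *)
Lemma vector_lattice_eq M v : submodule M -> M v -> unimodular v ->
  M = vector_lattice v (annihilator M).
Proof.
move=> sM Mv uv; have /unimodularP[p [q E]] := uv.
pose J : set A := [set x | exists2 w, M w & x = v.1 * w.2 - v.2 * w.1].
have iJ : ideal J.
  apply/idealP; split=> [|_ _ [w Mw ->] [w' Mw' ->]|a _ [w Mw ->]].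
  - by exists 0; [exact: submod0|rewrite !mulr0 subrr].
  - exists (w + w'); first exact: submodD.
    by rewrite -[(_ + _).1]/(w.1 + w'.1) -[(_ + _).2]/(w.2 + w'.2); ring.
  - exists (a *: w); first exact: submodZ.
    by rewrite -[(_ *: _).1]/(a * w.1) -[(_ *: _).2]/(a * w.2); ring.
suff ML : M = vector_lattice v J by rewrite [in RHS]ML vector_lattice_annihilator.
apply/seteqP; split=> [w Mw|w [w' Mw' ww']]; first by exists w.
rewrite -(subrK w' w); apply: submodD => //.
pose t : A := p * (w.1 - w'.1) + q * (w.2 - w'.2).
have -> : w - w' = t *: v.
  change ((w.1 - w'.1, w.2 - w'.2) = (t * v.1, t * v.2)); rewrite /t.
  have {}ww' : v.1 * (w.2 - w'.2) = v.2 * (w.1 - w'.1).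
    by apply/eqP; rewrite -subr_eq0; apply/eqP; move/eqP: ww'; rewrite -subr_eq0 => /eqP <-; ring.
  congr pair.
    transitivity (p * v.1 * (w.1 - w'.1) + q * (v.2 * (w.1 - w'.1))).
      by rewrite -[LHS]mul1r -E; ring.
    by rewrite -ww'; ring.
  transitivity (p * (v.1 * (w.2 - w'.2)) + q * v.2 * (w.2 - w'.2)).
    by rewrite -[LHS]mul1r -E; ring.
  by rewrite ww'; ring.
exact: submodZ.
Qed.

Lemma annihilator_nonzero M : cotorsion_submodules M -> nonzero_ideals (annihilator M).
Proof.
move=> coM; have [sM _] := coM; have [r r0 rM] := cotorsion_scalar coM.
apply/nonzero_idealP; split; last by exists r.
apply/idealP; split=> [v|x y hx hy v|a x hx v].
- by rewrite scale0r; exact: submod0.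
- by rewrite scalerDl; exact: submodD.
- by rewrite -scalerA; exact: submodZ.
Qed.

(** The class of v consists of the unimodular vectors of [vector_lattice v J]. A primitive lattice
    is recovered from this trace, since the trace is nonempty and any of its vectors determines the
    lattice once J is given. *)
Lemma PF1_fiber J : nonzero_ideals J ->
  let F := primitive `&` annihilator @^-1` [set J] in
  [/\ PF1 J = (fun M => @unimodular A `&` M) @` F,
      set_inj F (fun M => @unimodular A `&` M) &
      forall M, F M -> module_index M = ideal_norm J].
Proof.
move=> nzJ F; have [iJ _] := nzJ; split.
- apply/seteqP; split=> [_ [v uv <-]|_ [M [pM /= aM] <-]].
    exists (vector_lattice v J) => //; split; first exact: vector_lattice_primitive.
    exact: vector_lattice_annihilator.
  have [v Mv uv] := primitive_unimodular pM; have [[sM _] _] := pM.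
  by exists v => //; rewrite [in RHS](vector_lattice_eq sM Mv uv) aM.
- move=> M M'; rewrite !inE => -[pM /= aM] [pM' /= aM'] E.
  have [v Mv uv] := primitive_unimodular pM; have [[sM _] _] := pM.
  have [[sM' _] _] := pM'.
  have M'v : M' v.
    have : (@unimodular A `&` M) v by split.
    by rewrite E => -[].
  by rewrite (vector_lattice_eq sM Mv uv) (vector_lattice_eq sM' M'v uv) aM aM'.
- move=> M [pM /= aM]; have [v Mv uv] := primitive_unimodular pM; have [[sM _] _] := pM.
  by rewrite (vector_lattice_eq sM Mv uv) aM vector_lattice_index.
Qed.

End Free2.

(** * Convergence of the zeta function of ideals *)

Section RealSums.
Variable R : realType.

Lemma fsum_le_seq (T : choiceType) (B : set T) (s : seq T) (g : T -> R) :
  finite_set B -> uniq s -> (forall x, B x -> x \in s) ->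
  (forall x, x \in s -> 0 <= g x) ->
  \sum_(x \in B) g x <= \sum_(x <- s) g x.
Proof.
move=> fB us Bs g0; rewrite (fsbig_seq _ _ us).
rewrite [leRHS](fsbigID B) /=; last exact: finite_seq.
rewrite (setIidr _) ?lerDl; last by move=> x /Bs.
by apply: fsumr_ge0 => x [/= /g0].
Qed.

Lemma sum_le_geometric (q : R) : 0 <= q < 1 ->
  sum_le [set: nat] (fun k => q ^+ k) (1 - q)^-1.
Proof.
move=> /andP[q0 q1] B [fB _].
pose n := (\max_(k <- fset_set B) k).+1.
apply: (@le_trans _ _ (\sum_(k <- iota 0 n) q ^+ k)).
  apply: fsum_le_seq => //; first exact: iota_uniq.
    move=> k Bk; rewrite mem_iota /= add0n ltnS.
    by apply: leq_bigmax_seq => //; rewrite in_fset_set // inE.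
  by move=> k _; exact: exprn_ge0.
have -> : \sum_(k <- iota 0 n) q ^+ k = (1 - q ^+ n) / (1 - q).
  apply/(canRL (mulfK _)); first by rewrite subr_eq0 gt_eqF.
  rewrite -[iota 0 n]/(index_iota 0 n) big_mkord mulrC.
  by rewrite -opprB -[in RHS]opprB subrX1 mulNr.
rewrite -[leRHS]mul1r ler_pM2r ?invr_gt0 ?subr_gt0 //.
by rewrite lerBlDr lerDl exprn_ge0.
Qed.

Lemma fsum_le_const (T : choiceType) (B : set T) (s : seq T) (g : T -> R) c :
  finite_set B -> (forall x, B x -> x \in s) -> 0 <= c -> 
  (forall x, B x -> g x <= c) -> \sum_(x \in B) g x <= (size s)%:R * c.
Proof.
move=> fB Bs c0 gc; rewrite fsbig_finite //.
apply: (@le_trans _ _ (\sum_(x <- fset_set B) c)).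
  rewrite big_seq [leRHS]big_seq; apply: ler_sum => x.
  by rewrite in_fset_set // inE; exact: gc.
rewrite big_const_seq count_predT iter_addr_0 -[leLHS]mulr_natl ler_wpM2r // ler_nat.
apply: uniq_leq_size; first exact: fset_uniq.
by move=> x; rewrite in_fset_set // inE; exact: Bs.
Qed.

Lemma powR_natN_le (m n : nat) (t : R) : 0 <= t -> (0 < m <= n)%N ->
  n%:R `^ (- t) <= m%:R `^ (- t).
Proof.
move=> t0 /andP[m0 mn].
have n0 : (0 < n)%N by exact: leq_trans mn.
rewrite !powRN lef_pV2 ?posrE ?powR_gt0 ?ltr0n //.
by apply: ge0_ler_powR; rewrite ?nnegrE ?ler0n ?ler_nat.
Qed.

(** Condensation: the 2^k terms with 2^k <= m < 2^(k+1) are each at most 2^(-k t), so the blocks are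
    dominated by a geometric series of ratio 2^(1 - t) < 1. *)
Lemma sum_bounded_zeta (t : R) : 1 < t ->
  sum_bounded [set m : nat | (0 < m)%N] (fun m => m%:R `^ (- t)).
Proof.
move=> t1; have t0 : 0 <= t by rewrite ltW // (lt_trans _ t1).
pose q : R := 2 * 2 `^ (- t).
have q01 : 0 <= q < 1.
  rewrite /q mulr_ge0 ?powR_ge0 //= powRN ltr_pdivrMr ?powR_gt0 // mul1r.
  rewrite /powR pnatr_eq0 /= -[X in X < _](@lnK R 2) ?posrE // ltr_expR.
  by rewrite -[X in X < _]mul1r ltr_pM2r // ln_gt0 // ltr1n.
exists (1 - q)^-1.
apply: (@sum_le_fiber _ _ _ _ _ (trunc_log 2) _ _ _ _ (sum_le_geometric q01)) => //.
move=> k _ B [fB BD].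
have Bk m : B m -> (2 ^ k <= m < 2 ^ k.+1)%N.
  move=> /BD[/= m0 <-]; exact: trunc_log_bounds.
apply: (@le_trans _ _ ((size (iota (2 ^ k) (2 ^ k)))%:R * (2 ^ k)%:R `^ (- t))).
  apply: fsum_le_const => //; first by move=> m /Bk; rewrite mem_iota addnn -mul2n -expnS.
  by move=> m /Bk/andP[h _]; apply: powR_natN_le => //; rewrite expn_gt0.
rewrite size_iota exprMn natrX -!powR_mulrn ?powR_ge0 //.
by rewrite -!powRrM (mulrC (- t)).
Qed.

End RealSums.

Section Euler.
Variables (R : realType) (A : comNzRingType).
Implicit Types (I J P Q : set A) (a b x y : A).

Hypothesis domA : torsion_free (A^o : lmodType A).
Hypothesis finA : finite_quotients A.
Hypothesis intA : integrally_closed A.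
Hypothesis rankA : finite_rank A.

(** * Maximal ideals and the existence of factorisations *)

Definition maxideal P := [/\ nonzero_ideals P, ~ P 1 &
  forall x, ~ P x -> exists y, P (1 - x * y)].

Lemma ideal_norm_lt I J : nonzero_ideals I -> ideal J -> I `<=` J ->
  ~ (J `<=` I) -> (ideal_norm J < ideal_norm I)%N.
Proof.
move=> nzI iJ IJ JI; have [iI _] := nzI.
have [_ [le eq]] := @fin_indexS _ A^o I J iI iJ IJ (nonzero_ideal_fin finA nzI).
by rewrite ltn_neqAle le andbT /ideal_norm eq; apply/asboolP.
Qed.

Lemma nonzero_idealS I J : nonzero_ideals I -> ideal J -> I `<=` J ->
  nonzero_ideals J.
Proof.
move=> /nonzero_idealP[iI [a Ia a0]] iJ IJ.
by apply/nonzero_idealP; split=> //; exists a => //; exact: IJ.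
Qed.

(** Induction on the norm: if x has no inverse modulo I, then I + (x) is proper and has smaller
    norm. *)
Lemma exists_maxideal I : nonzero_ideals I -> ~ I 1 ->
  exists2 P, maxideal P & I `<=` P.
Proof.
have [n] := ubnP (ideal_norm I); elim: n I => // n ih I In nzI I1.
have [iI _] := nzI.
have [max|/existsNP[x /not_implyP[Ix /forallNP nx]]] :=
  pselect (forall x, ~ I x -> exists y, I (1 - x * y)); first by exists I.
pose I2 := [set z | exists y, I (z - x * y)].
have II2 : I `<=` I2 by move=> z Iz; exists 0; rewrite mulr0 subr0.
have iI2 : ideal I2.
  apply/idealP; split=> [|z w [y hz] [y' hw]|a z [y hz]].
  - by apply: II2; exact: ideal0.
  - by exists (y + y'); rewrite mulrDr opprD addrACA; exact: idealD.
  - by exists (a * y); rewrite mulrCA -mulrBr; exact: idealM.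
have [||P mP I2P] := ih I2 _ (nonzero_idealS nzI iI2 II2).
- rewrite ltnS in In; apply: leq_trans In; apply: ideal_norm_lt => // sub.
  by apply: Ix; apply: sub; exists 1; rewrite mulr1 subrr; exact: ideal0.
- by move=> [y]; exact: nx.
by exists P => // z /II2/I2P.
Qed.

Lemma ideal_norm_gt1 P : nonzero_ideals P -> ~ P 1 -> (1 < ideal_norm P)%N.
Proof.
move=> nzP P1; have [iP _] := nzP.
apply: (@incongruent_leq_index A A^o P 2 (fun i => (i : nat)%:R)) => //.
  exact: nonzero_ideal_fin.
move=> [[|[|i]] hi] [[|[|j]] hj] //= h; apply: val_inj => //=.
  by case: P1; move: h => /= /(idealN iP); rewrite sub0r opprK.
by case: P1; move: h => /=; rewrite subr0.
Qed.

Lemma smul_comm P Q I :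
  smul P (smul Q (I : set A^o)) = smul Q (smul P (I : set A^o)).
Proof.
have key X Y : smul X (smul Y (I : set A^o)) `<=` smul Y (smul X (I : set A^o)).
  apply: smul_sub => [|a u Xa hu]; first exact: smul_submod.
  have sub : smul Y (I : set A^o) `<=`
    [set u | smul Y (smul X (I : set A^o)) (a *: u)].
    apply: smul_sub => [|b w Yb Iw /=]; first exact/preim_scale_submod/smul_submod.
    by rewrite scalerA mulrC -scalerA; do 2 apply: smulZ => //.
  exact: sub.
by apply/seteqP; split; exact: key.
Qed.

Inductive generated (S : set (set A)) : set A -> Prop :=
| generated_one : generated S setT
| generated_smul P I : S P -> generated S I ->
    generated S (smul P (I : set A^o)).

Lemma generatedS (S S' : set (set A)) I : S `<=` S' ->
  generated S I -> generated S' I.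
Proof.
by move=> SS'; elim=> [|P J /SS' ? _ ?]; [exact: generated_one|exact: generated_smul].
Qed.

(** For P maximal above I, I = P (I : P), and the norm of the cofactor is smaller by the factor N(P)
    > 1. *)
Lemma nonzero_generated I : nonzero_ideals I ->
  exists L : seq (set A), [/\ forall P, P \in L -> maxideal P &
    generated [set` L] I].
Proof.
have [n] := ubnP (ideal_norm I); elim: n I => // n ih I In nzI.
have [iI _] := nzI.
have [I1|I1] := pselect (I 1).
  by exists [::]; split=> //; rewrite (ideal_setT iI I1); exact: generated_one.
have [P mP IP] := exists_maxideal nzI I1; have [nzP P1 _] := mP.
have [iP _] := nzP.
have invP := nonzero_invertible domA finA intA nzP.
have E : smul P (colon P (I : set A^o)) = I.
  by apply: (smul_colon domA invP iI); rewrite smul_setT.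
have IcP : I `<=` colon P (I : set A^o).
  by move=> x Ix a _; exact: idealM.
have nzc := nonzero_idealS nzI (colon_submod P iI) IcP.
have [|L [LM Lg]] := ih (colon P (I : set A^o)) _ nzc.
  have := ideal_norm_smul domA finA intA nzP nzc; rewrite E => EN.
  rewrite ltnS EN in In; apply: leq_trans In.
  rewrite ltn_Pmull ?ideal_norm_gt1 //; apply: module_index_gt0.
    exact: colon_submod.
  exact: nonzero_ideal_fin.
exists (P :: L); split=> [Q|].
  by rewrite inE => /orP[/eqP -> //|/LM].
rewrite -E; apply: generated_smul; first by rewrite /= mem_head.
by apply: generatedS Lg => Q /= QL; rewrite inE QL orbT.
Qed.

Section Weight.
Variable t : R.
Hypothesis t1 : 1 < t.

Let t0 : 0 <= t. Proof. by rewrite ltW // (lt_trans _ t1). Qed.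

(** * The Euler product bound *)

Definition weight I : R := (ideal_norm I)%:R `^ (- t).

Lemma weight_ge0 I : 0 <= weight I. Proof. exact: powR_ge0. Qed.

Lemma weight_smul I J : nonzero_ideals I -> nonzero_ideals J ->
  weight (smul I (J : set A^o) : set A) = weight I * weight J.
Proof.
by move=> nzI nzJ; rewrite /weight ideal_norm_smul // natrM powRM ?ler0n.
Qed.

Lemma weight_max P : maxideal P -> 0 <= weight P <= 2^-1.
Proof.
move=> [nzP P1 _]; rewrite weight_ge0 /=.
apply: (le_trans (@powR_natN_le _ 2 _ t t0 _)); first by rewrite ideal_norm_gt1.
rewrite powRN lef_pV2 ?posrE ?powR_gt0 // le1r_powR ?ler1n //; exact: ltW.
Qed.

Lemma nonzero_setT : nonzero_ideals [set: A].
Proof.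
by apply/nonzero_idealP; split; [exact: submodule_setT|exists 1; rewrite ?oner_eq0].
Qed.

Lemma generated_nonzero (S : set (set A)) I : S `<=` maxideal ->
  generated S I -> nonzero_ideals I.
Proof.
move=> SM; elim=> [|P J /SM[nzP _ _] _ nzJ]; first exact: nonzero_setT.
exact: nonzero_smul.
Qed.

Lemma weight_iter P k J : maxideal P -> nonzero_ideals J ->
  nonzero_ideals (iter k (fun J => smul P (J : set A^o)) J) /\
  weight (iter k (fun J => smul P (J : set A^o)) J) = weight P ^+ k * weight J.
Proof.
move=> [nzP _ _] nzJ; elim: k => [|k [ih1 ih2]] /=; first by rewrite mul1r.
by split; [exact: nonzero_smul|rewrite weight_smul // ih2 exprS mulrA].
Qed.

(** The pairs (k, J) |-> P^k J reach every product over P :: L, which splits off a geometric series.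
    Reaching an ideal repeatedly is harmless for an upper bound, the weights being nonnegative. *)
Lemma sum_le_generated (L : seq (set A)) : (forall P, P \in L -> maxideal P) ->
  sum_le (generated [set` L]) weight (\prod_(P <- L) (1 - weight P)^-1).
Proof.
elim: L => [_|P L ih LM].
  have gT : generated [set` [::]] `<=` [set [set: A]] by move=> I [].
  move=> B [fB BT]; rewrite big_nil.
  have -> : (1 : R) = \sum_(I \in [set [set: A]]) weight I.
    rewrite fsbig_set1 /weight /ideal_norm.
    by have [-> _] := @module_index_setT A A^o; rewrite powR1.
  rewrite [leRHS](fsbigID B) /=; last exact: finite_set1.
  rewrite (setIidr _); last by move=> I /BT/gT.
  by rewrite lerDl; apply: fsumr_ge0 => I _; exact: weight_ge0.
have mP : maxideal P by apply: LM; rewrite mem_head.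
have LM' Q : Q \in L -> maxideal Q by move=> QL; apply: LM; rewrite inE QL orbT.
rewrite big_cons.
pose h (kJ : nat * set A) := iter kJ.1 (fun J => smul P (J : set A^o)) kJ.2.
apply: (@sum_le_surj R _ _ (setT `*` generated [set` L]) _ h).
  move=> I; elim=> [|Q J /=]; first by exists (0%N, setT) => //; split=> //; exact: generated_one.
  rewrite inE => /orP[/eqP ->|QL] _ [[k J'] [_ /= gJ'] <-].
    by exists (k.+1, J').
  exists (k, smul Q (J' : set A^o)); first by split=> //; exact: generated_smul.
  rewrite /h /=; elim: k => //= k ->; exact: smul_comm.
have /andP[w0 w1] := weight_max mP.
have H : sum_le (setT `*` generated [set` L]) (fun kJ => weight P ^+ kJ.1 * weight kJ.2)
   ((1 - weight P)^-1 * \prod_(P <- L) (1 - weight P)^-1).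
  apply: sum_leX (ih LM'); first by move=> k _; exact: exprn_ge0.
  apply: sum_le_geometric; rewrite w0 /=; lra.
move=> B BD; apply: le_trans (H _ BD).
rewrite le_eqVlt; apply/orP; left; apply/eqP/eq_fsbigr => -[k J].
rewrite inE => /(BD.2)[_ /= gJ].
have [] := @weight_iter P k J mP; last by [].
exact: generated_nonzero gJ.
Qed.


(* The least positive integer in P, or 0 if there is none. *)
Definition residue_char P : nat :=
  if pselect (exists m, (0 < m)%N && `[< P m%:R >]) is left h then ex_minn h else 0%N.

Lemma residue_charP P : maxideal P -> [/\ (1 < residue_char P)%N, P (residue_char P)%:R &
  forall m n, (m < residue_char P)%N -> (n < residue_char P)%N -> P (m%:R - n%:R) -> m = n].
Proof.
move=> [nzP P1 _]; have [iP _] := nzP.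
have finP := nonzero_ideal_fin finA nzP.
have ex : exists m, (0 < m)%N && `[< P m%:R >].
  apply: contrapT => /forallNP nex.
  (* If P contained no positive integer, 0, ..., N(P) would be N(P) + 1 incongruent elements. *)
  suff : ((ideal_norm P).+1 <= ideal_norm P)%N by rewrite ltnn.
  apply: (@incongruent_leq_index A A^o P _ (fun i => (i : nat)%:R) iP finP).
  have key (i j : nat) : (i < j)%N -> ~ P (j%:R - i%:R).
    move=> ij Pij; apply: (nex (j - i)%N); rewrite subn_gt0 ij /=.
    by apply/asboolP; rewrite natrB // ltnW.
  move=> i j Pij; apply: val_inj => /=; case: (ltngtP i j) => // h.
    by case: (key _ _ h); exact: ideal_subr.
  by case: (key _ _ h).
rewrite /residue_char; case: pselect => // h; case: ex_minnP => n /andP[n0 /asboolP Pn] nmin.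
have key (i j : nat) : (j < n)%N -> (i < j)%N -> ~ P (j%:R - i%:R).
  move=> jn ij; rewrite -natrB ?(ltnW ij) // => Pij.
  have := nmin (j - i)%N; rewrite subn_gt0 ij /= => /(_ (asboolT Pij)).
  by rewrite leqNgt (leq_ltn_trans (leq_subr _ _) jn).
split=> // [|i j ni nj Pij].
  by case: n n0 Pn {nmin key} => [|[|n]].
case: (ltngtP i j) => // h'.
  by case: (key _ _ nj h'); exact: ideal_subr.
by case: (key _ _ ni h').
Qed.

Lemma residue_char_le_norm P : maxideal P -> (residue_char P <= ideal_norm P)%N.
Proof.
move=> mP; have [_ _ cP] := residue_charP mP; have [nzP _ _] := mP; have [iP _] := nzP.
apply: (@incongruent_leq_index A A^o P _ (fun i => (i : nat)%:R) iP).
  exact: nonzero_ideal_fin.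
by move=> i j /cP h; apply: val_inj; exact: h.
Qed.

Lemma maxideal_sub P Q : maxideal P -> maxideal Q -> P `<=` Q -> P = Q.
Proof.
move=> [_ P1 mP] [[iQ _] Q1 _] PQ; apply/seteqP; split=> // x Qx.
apply: contrapT => /mP[y Py]; apply: Q1.
by rewrite -(subrK (x * y) 1); apply: idealD => //; [exact: PQ|exact: idealMr].
Qed.

(* By the Chinese remainder theorem the ideals of L produce m ^ size L
   incongruent elements modulo m. *)
Lemma maxideal_count (d m : nat) (L : seq (set A)) :
  fin_index (principal (m%:R : A) : set A^o) ->
  (module_index (principal (m%:R : A) : set A^o) <= m ^ d)%N -> uniq L ->
  (forall P, P \in L -> maxideal P /\ residue_char P = m) -> (size L <= d)%N.
Proof.
move=> finm indm uL LM; have [->//|L0] := eqVneq L [::].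
pose P (i : 'I_(size L)) := nth setT L i.
have PL i : P i \in L by exact: mem_nth.
have mP i : maxideal (P i) by have [] := LM _ (PL i).
have iP i : ideal (P i) by case: (mP i) => -[].
have cP i : residue_char (P i) = m by have [] := LM _ (PL i).
have m1 : (1 < m)%N.
  have L1 : (0 < size L)%N by rewrite lt0n size_eq0.
  by have [] := residue_charP (mP (Ordinal L1)); rewrite cP.
have /choice[u uP] (ij : 'I_(size L) * 'I_(size L)) :
    exists v, ij.1 != ij.2 -> P ij.2 v /\ P ij.1 (1 - v).
  case: ij => i j /=; have [ij|ij] := eqVneq i j; first by exists 0.
  have [x Px Qx] : exists2 x, P j x & ~ P i x.
    apply: contrapT => h; have PQ : P j `<=` P i.
      by move=> x Px; apply: contrapT => Qx; apply: h; exists x.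
    have /eqP := maxideal_sub (mP j) (mP i) PQ.
    by rewrite nth_uniq // => /eqP/val_inj ji; rewrite ji eqxx in ij.
  have [_ _ /(_ _ Qx)[y Py]] := mP i.
  by exists (x * y) => _; split=> //; exact: idealMr.
(* [e i] is 1 modulo [P i] and 0 modulo the other members of L. *)
pose e i := \prod_(j | i != j) u (i, j).
have e1 i : P i (1 - e i).
  rewrite /e; elim/big_ind: _ => [|x y hx hy|j ij].
  - by rewrite subrr; exact: ideal0.
  - have -> : 1 - x * y = (1 - x) + x * (1 - y) by ring.
    by apply: idealD => //; exact: idealM.
  - by have [] := uP (i, j) ij.
have e0 i j : i != j -> P j (e i).
  move=> ij; rewrite /e (bigD1 j) //=; apply: idealMr => //.
  by have [] := uP (i, j) ij.
(* The digits [c i] are recovered modulo [P i], as integers below the residue characteristic m are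
   incongruent there. *)
pose X (c : {ffun 'I_(size L) -> 'I_m}) : A := \sum_i (c i : nat)%:R * e i.
have XP c i : P i (X c - (c i : nat)%:R).
  rewrite /X (bigD1 i) //= addrAC; apply: idealD => //.
    rewrite -{2}[(c i : nat)%:R]mulr1 -mulrBr; apply: idealM => //.
    exact: ideal_subr.
  elim/big_ind: _ => [|x y hx hy|j ji]; first exact: ideal0.
    exact: idealD.
  by apply: idealM => //; exact: e0.
have Xinj c c' : principal m%:R (X c - X c') -> c = c'.
  move=> h; apply/ffunP => i; apply: val_inj => /=.
  have [_ Pm H] := residue_charP (mP i); rewrite cP in Pm H.
  apply: H => //; have {}h : P i (X c - X c') by apply: principal_sub h.
  apply: (ideal_trans (iP i)) (XP c' i); apply: (ideal_trans (iP i) _ h).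
  exact: ideal_subr.
have im := ideal_principal (m%:R : A).
have leX : (#|{ffun 'I_(size L) -> 'I_m}| <= m ^ d)%N.
  apply: leq_trans indm; apply: (@incongruent_leq_index A A^o _ _ (X \o enum_val)) => //.
  by move=> i j /Xinj/enum_val_inj.
by rewrite card_ffun !card_ord leq_exp2l in leX.
Qed.

Lemma sum_bounded_maxideal : sum_bounded maxideal weight.
Proof.
have [d dP] := rankA; have [C hC] := sum_bounded_zeta t1.
apply: (@sum_bounded_fiber R _ _ _ [set m : nat | (0 < m)%N] residue_char _
  (fun m => d%:R * m%:R `^ (- t))).
- by move=> P /residue_charP[h _ _] /=; exact: ltnW.
- exists (d%:R * C) => B /hC h.
  by rewrite -mulr_fsumr ler_wpM2l.
- move=> m /= m0 B [fB BD].
  have [finm indm] := dP m m0.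
  apply: (@le_trans _ _ ((size (fset_set B))%:R * m%:R `^ (- t))).
    apply: fsum_le_const => //; first by move=> P BP; rewrite in_fset_set // inE.
    move=> P /BD[mP /= cP]; apply: powR_natN_le => //.
    by rewrite m0 -cP residue_char_le_norm.
  rewrite ler_wpM2r ?powR_ge0 // ler_nat.
  apply: (maxideal_count finm indm); first exact: fset_uniq.
  by move=> P; rewrite in_fset_set // inE => /BD[].
Qed.

Lemma sum_bounded_ideal : sum_bounded (@nonzero_ideals A) weight.
Proof.
have [C hC] := sum_bounded_maxideal; exists (expR (2 * C)) => B [fB BD].
have /choice[L LP] I : exists L : seq (set A), B I ->
    (forall P, P \in L -> maxideal P) /\ generated [set` L] I.
  case: (pselect (B I)) => [/BD/nonzero_generated[L [h1 h2]]|]; [by exists L|by exists [::]].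
(* A finite set of ideals involves finitely many maximal ideals, so a finite Euler product bounds
   its sum. *)
pose L0 := undup (flatten [seq L X | X <- fset_set B]).
have L0M P : P \in L0 -> maxideal P.
  rewrite mem_undup => /flatten_mapP[I]; rewrite in_fset_set // inE.
  by move=> /LP[h _]; exact: h.
have BL : B `<=` generated [set` L0].
  move=> I BI; have [_] := LP I BI; apply: generatedS => P /= PL.
  rewrite mem_undup; apply/flatten_mapP; exists I => //.
  by rewrite in_fset_set // inE.
apply: (le_trans (sum_le_generated L0M (conj fB BL))).
(* For 0 <= w <= 1/2, 1 / (1 - w) <= 1 + 2 w <= exp (2 w): this is the origin of the 2 in the
   constant. *)
apply: (@le_trans _ _ (\prod_(P <- L0) expR (2 * weight P))).
  rewrite [leLHS]big_seq [leRHS]big_seq; apply: ler_prod => P /L0M/weight_max/andP[w0 w1].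
  rewrite invr_ge0 subr_ge0 (le_trans w1) ?invf_le1 ?ler1n //=.
  have h : 0 < 1 - weight P by lra.
  apply: (@le_trans _ _ (1 + 2 * weight P)); last exact: expR_ge1Dx.
  rewrite -[leLHS]mul1r ler_pdivrMr //; nra.
rewrite -expR_sum ler_expR -mulr_sumr ler_wpM2l //.
rewrite (fsbig_seq _ _ (undup_uniq _)); apply: hC.
by split; [exact: finite_seq|move=> P /= /L0M].
Qed.

End Weight.

End Euler.

(** * The ring of integers of a number field *)

Lemma common_denominator (I : finType) (q : I -> rat) :
  exists2 D : int, D != 0 & exists z : I -> int, forall i, D%:~R * q i = (z i)%:~R.
Proof.
exists (\prod_i denq (q i)); first by apply/prodf_neq0 => i _; exact: denq_neq0.
exists (fun i => numq (q i) * \prod_(j | j != i) denq (q j)) => i.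
by rewrite (bigD1 i) //= !rmorphM /= numqE; ring.
Qed.

Section RingOfIntegers.
Variable K : fieldExtType rat.
Local Notation OK := (ring_of_integers K).

Definition algint_rmorphism : {rmorphism OK -> K} := \val.
Local Notation iota := algint_rmorphism.

Lemma algint_inj : injective iota. Proof. exact: val_inj. Qed.

Lemma algint_integralOver (x : OK) : integralOver (intr : int -> K) (iota x).
Proof. by apply/asboolP; exact: (valP x). Qed.

Lemma ring_of_integers_torsion_free : torsion_free (OK^o : lmodType OK).
Proof.
move=> a v /(congr1 iota); rewrite -[a *: v]/(a * v) rmorphM rmorph0.
by move=> /eqP; rewrite mulf_eq0 => /orP[] /eqP h; [left|right];
  apply: algint_inj; rewrite rmorph0.
Qed.

(** Smith reduction of the coordinate matrix writes the N + 1 elements as x = L y, where only the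
    first d = [K : Q] entries of y can be nonzero. Modulo m each x i is determined by d residues,
    which leaves m^d = N possibilities. *)
Lemma int_combination_mod (m N : nat) (x : 'I_N.+1 -> OK) :
  (0 < m)%N -> N = (m ^ \dim {:K})%N ->
  exists i j, i != j /\ principal (m%:R : OK) (x i - x j).
Proof.
move=> m0 NE; set d := \dim {:K} in NE.
pose q (ik : 'I_N.+1 * 'I_d) : rat := coord (vbasis {:K}) ik.2 (iota (x ik.1)).
have [D D0 [z zP]] := common_denominator q.
pose X : 'M[int]_(N.+1, d) := \matrix_(i, k) z (i, k).
have [L uL [T _ [ds _ XE]]] := int_Smith_normal_form X.
pose y (j : 'I_N.+1) : OK := \sum_i x i *~ (invmx L j i).
have xy i : x i = \sum_j y j *~ L i j.
  transitivity (\sum_k x k *~ (L *m invmx L) i k).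
    rewrite mulmxV // (bigD1 i) //= mxE eqxx big1 ?addr0 // => k ki.
    by rewrite mxE eq_sym (negbTE ki).
  under eq_bigr => k _ do rewrite mxE mulrz_sumr.
  rewrite exchange_big /=; apply: eq_bigr => j _; rewrite mulrz_suml.
  by apply: eq_bigr => k _; rewrite mulrC mulrzA.
(* Row j of the rectangular diagonal matrix is zero for j >= d, so all coordinates of [y j]
   vanish. *)
have y0 (j : 'I_N.+1) : (d <= j)%N -> y j = 0.
  move=> dj; apply: algint_inj; rewrite rmorph0.
  rewrite (coord_vbasis (memvf (iota (y j)))) big1 // => k _.
  suff /eqP : D%:~R * coord (vbasis {:K}) k (iota (y j)) = 0.
    by rewrite mulf_eq0 intr_eq0 (negbTE D0) => /eqP ->; rewrite scale0r.
  transitivity (((invmx L *m X) j k)%:~R : rat).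
    rewrite mxE rmorph_sum linear_sum mulr_sumr rmorph_sum.
    apply: eq_bigr => i _; rewrite rmorphMz raddfMz /= rmorphM /= mxE -zP /q /=.
    by rewrite -[_ *~ invmx L j i]mulrzl mulrCA.
  rewrite XE !mulmxA mulVmx // mul1mx mxE big1 // => l _; rewrite mxE.
  by rewrite gtn_eqF ?mulr0n ?mul0r // (leq_trans (ltn_ord l)).
(* [inord] is consulted only at indices below [N.+1], where it preserves the value. *)
pose res (i : 'I_N.+1) : {ffun 'I_d -> 'I_m} :=
  [ffun j : 'I_d => Ordinal (ltn_pmod `|(L i (inord j) %% m)%Z|%N m0)].
have /injectivePn[i [i' ii' rii']] : ~~ injectiveb res.
  apply/negP => /injectiveP/leq_card.
  by rewrite card_ffun !card_ord -NE ltnn.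
exists i, i'; split=> //.
have Lmod (j : 'I_N.+1) : (j < d)%N -> (m %| L i j - L i' j)%Z.
  move=> jd; have /ffunP/(_ (Ordinal jd)) := rii'; rewrite !ffunE => /(congr1 val) /=.
  have -> : inord j = j by apply: val_inj; rewrite /= inordK.
  have mz : m%:Z != 0 by rewrite -lt0n.
  have lt b : (`|(b %% m)%Z| < m)%N.
    by rewrite -ltz_nat gez0_abs ?modz_ge0 // ltz_pmod.
  rewrite !modn_small // => /(congr1 Posz); rewrite !gez0_abs ?modz_ge0 // => E.
  by rewrite -eqz_mod_dvd; apply/eqP.
exists (\sum_j y j *~ ((L i j - L i' j) %/ m)%Z) => //.
rewrite mulr_suml !xy -sumrB; apply: eq_bigr => j _.
have [jd|/y0 ->] := ltnP j d; last by rewrite !mul0rz mul0r subrr.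
rewrite -mulrzBr -[in RHS](divzK (Lmod j jd)) mulrzA.
by rewrite mulr_natr pmulrn.
Qed.

Lemma ring_of_integers_rank : finite_rank OK.
Proof.
exists (\dim {:K}) => m m0; apply: (@fin_index_pigeonhole OK OK^o).
  exact: ideal_principal.
by move=> x; exact: int_combination_mod.
Qed.

Lemma algint_monic_root (a : OK) :
  exists2 p : {poly int}, p \is monic & (map_poly intr p).[a] = 0.
Proof.
have [p pm /rootP pa] := algint_integralOver a; exists p => //.
apply: algint_inj; rewrite rmorph0 -pa -horner_map -map_poly_comp.
by congr (_.[_]); apply: eq_map_poly => z; exact: (rmorph_int iota).
Qed.

(** Starting from a monic relation, X is divided out while the constant term vanishes. The nonzero
    constant term c then satisfies c = - a q(a). *)
Lemma dvd_nonzero_nat (a : OK) : a != 0 ->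
  exists2 m : nat, (0 < m)%N & principal a m%:R.
Proof.
move=> a0; have [p pm] := algint_monic_root a.
have {pm} : p != 0 by exact: monic_neq0.
elim/poly_ind: p => [|p c ih]; first by rewrite eqxx.
rewrite rmorphD rmorphM /= map_polyX map_polyC /= hornerD hornerM hornerX hornerC.
have [->|c0 _ /eqP] := eqVneq c 0.
  rewrite polyC0 addr0 mulf_eq0 negb_or => /andP[p0 _].
  rewrite rmorph0 addr0 => /(@ring_of_integers_torsion_free _ a)[/ih h|/eqP].
    exact: h.
  by rewrite (negbTE a0).
rewrite addr_eq0 => /eqP E; exists `|c|%N; first by rewrite absz_gt0.
exists (- (sgz c)%:~R * (map_poly intr p).[a]) => //.
rewrite -mulrA E mulrNN -rmorphM /=.
by rewrite -[RHS]/(((`|c|%N : int)%:~R) : OK) abszEsg.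
Qed.

Lemma ring_of_integers_fin_index : finite_quotients OK.
Proof.
move=> a /dvd_nonzero_nat[m m0 am]; have [d dP] := ring_of_integers_rank.
have [fm _] := dP m m0.
have [|//] := @fin_indexS OK OK^o (principal m%:R) (principal a)
  (ideal_principal _) (ideal_principal _) _ fm.
by apply: principal_sub => //; exact: ideal_principal.
Qed.

(** b / a is an eigenvalue of the coefficient matrix, with the generators as eigenvector, hence a
    root of a monic polynomial with integral coefficients. *)
Lemma ring_of_integers_closed : integrally_closed OK.
Proof.
move=> n c a b a0 [i0 ci0] /choice[t tP].
have ia0 : iota a != 0 by rewrite -(rmorph0 iota) (inj_eq algint_inj).
pose T : 'M[OK]_n := \matrix_(j, i) t i j.
pose x := iota b / iota a.
have intx : integralOver (intr : int -> K) x.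
  apply: (@integral_root_monic _ _ _ _ (map_poly iota (char_poly T))).
  - by rewrite map_char_poly char_poly_monic.
  - rewrite map_char_poly -eigenvalue_root_char; apply/eigenvalueP.
    exists (\row_j iota (c j)); last first.
      apply/eqP => /rowP/(_ i0); rewrite !mxE -(rmorph0 iota) => /algint_inj/eqP.
      by rewrite (negbTE ci0).
    apply/rowP => i; rewrite !mxE /x; apply: (mulfI ia0).
    rewrite mulrA mulrCA divff // mulr1 -rmorphM tP rmorphM rmorph_sum; congr (_ * _).
    by apply: eq_bigr => j _; rewrite !mxE -rmorphM mulrC.
  - move=> z /(nthP 0)[k _ <-]; rewrite coef_map; exact: algint_integralOver.
exists (@RingOfIntegers K x (asboolT intx)) => //; apply: algint_inj.
by rewrite rmorphM /= /x divfK.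
Qed.

End RingOfIntegers.

(** * The zeta functions *)

Section ZetaFunctions.
Variables (R : realType) (A : comNzRingType).
Implicit Types (I J : set A) (M : set (free2 A)) (s : R[i]).

Hypothesis domA : torsion_free (A^o : lmodType A).
Hypothesis finA : finite_quotients A.
Hypothesis intA : integrally_closed A.
Hypothesis rankA : finite_rank A.

Lemma fsum_const (V : pzSemiRingType) (T : choiceType) (D : set T) (f : T -> V) (c : V) :
  finite_set D -> (forall x, D x -> f x = c) ->
  \sum_(x \in D) f x = (set_card D)%:R * c.
Proof.
move=> finD fc; rewrite (eq_fsbigr (fun=> c)); last by move=> x; rewrite inE; exact: fc.
by rewrite fsbig_finite // big_const_seq count_predT iter_addr_0 mulr_natl.
Qed.

Lemma ideal_norm_gt0 I : nonzero_ideals I -> (0 < ideal_norm I)%N.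
Proof.
move=> nzI; have [iI _] := nzI; apply: module_index_gt0 => //.
exact: nonzero_ideal_fin.
Qed.

Lemma cotorsion_index_gt0 M : cotorsion_submodules M -> (0 < module_index M)%N.
Proof.
move=> coM; have [sM _] := coM; have [finM _] := cotorsion_index finA coM.
exact: module_index_gt0.
Qed.

Lemma norm_inv_natcpow n s : (0 < n)%N ->
  `|1 / natcpow n s| = (n%:R `^ (- complex.Re s))%:C%C.
Proof.
by move=> n0; rewrite normrM normr1 mul1r normfV norm_natcpow // powRN fmorphV.
Qed.

Lemma has_csum_zeta s : 1 < complex.Re s ->
  exists l, has_csum (@nonzero_ideals A) (zeta_ideal_term s) l.
Proof.
move=> s1; apply: has_csum_bounded (sum_bounded_ideal domA finA intA rankA s1) _ => I nzI.
by rewrite norm_inv_natcpow ?ideal_norm_gt0.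
Qed.

(** The fibre over (I, J) has N(J) members of index N(I) N(J) and contributes N(I)^(-t) N(J)^(1 -
    t). The second exponent requires t - 1 > 1. *)
Lemma sum_bounded_O2 (t : R) : 2 < t ->
  sum_bounded (@cotorsion_submodules A) (fun M => (module_index M)%:R `^ (- t)).
Proof.
move=> t2; have t1 : 1 < t by lra.
have t1' : 1 < t - 1 by lra.
pose nz := @nonzero_ideals A.
apply: (@sum_bounded_fiber R _ _ _ (nz `*` nz) (fun M => (snd_ideal M, fst_ideal M)) _
  (fun IJ => weight t IJ.1 * weight (t - 1) IJ.2)).
- by move=> M /cotorsion_nonzero[].
- apply: sum_boundedX; first by move=> I _; exact: weight_ge0.
    exact: sum_bounded_ideal.
  exact: sum_bounded_ideal.
move=> [I J] [/= nzI nzJ] B [fB BF].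
have [finF cardF] := fiber_card domA finA intA nzI nzJ.
set F := (X in finite_set X) in finF; rewrite -/F in BF cardF.
have I0 := ideal_norm_gt0 nzI; have J0 := ideal_norm_gt0 nzJ.
apply: (@le_trans _ _ ((size (fset_set F))%:R * (ideal_norm I * ideal_norm J)%:R `^ (- t))).
  apply: fsum_le_const => //.
  - by move=> M /BF FM; rewrite in_fset_set // inE.
  - move=> M /BF[coM /= [<- <-]].
    by have [_ ->] := cotorsion_index finA coM.
rewrite -[size _]/(set_card F) cardF natrM powRM ?ler0n // mulrCA /weight.
rewrite ler_wpM2l ?powR_ge0 // -[X in X * _]powRr1 ?ler0n //.
by rewrite -powRD ?pnatr_eq0 ?gtn_eqF ?implybT // opprB addrC.
Qed.

Lemma has_csum_O2 s : 2 < complex.Re s ->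
  exists l, has_csum (@cotorsion_submodules A) (@zeta_O2_term R A s) l.
Proof.
move=> s2; apply: has_csum_bounded (sum_bounded_O2 s2) _ => M coM.
by rewrite norm_inv_natcpow ?cotorsion_index_gt0.
Qed.

Lemma zeta_O2_product s l l1 l2 : 2 < complex.Re s ->
  has_csum (@cotorsion_submodules A) (@zeta_O2_term R A s) l ->
  has_csum (@nonzero_ideals A) (zeta_ideal_term (s - 1)) l1 ->
  has_csum (@nonzero_ideals A) (zeta_ideal_term s) l2 ->
  l = l1 * l2.
Proof.
move=> s2 hl h1 h2; pose nz := @nonzero_ideals A.
have hX : has_csum (nz `*` nz)
    (fun IJ => zeta_ideal_term s IJ.1 * zeta_ideal_term (s - 1) IJ.2) l.
  apply: (has_csum_fiber (p := fun M => (snd_ideal M, fst_ideal M)) _ hl).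
    by move=> M /cotorsion_nonzero[].
  move=> [I J] [/= nzI nzJ].
  have [finF cardF] := fiber_card domA finA intA nzI nzJ.
  have I0 := ideal_norm_gt0 nzI; have J0 := ideal_norm_gt0 nzJ.
  suff <- : \sum_(M \in @cotorsion_submodules A `&`
      (fun M => (snd_ideal M, fst_ideal M)) @^-1` [set (I, J)]) zeta_O2_term s M =
      zeta_ideal_term s I * zeta_ideal_term (s - 1) J by exact: has_csum_finite.
  rewrite (fsum_const (c := zeta_ideal_term s I * zeta_ideal_term s J)) //.
    rewrite cardF mulrCA; congr (_ * _).
    rewrite /zeta_ideal_term (natcpowB1 s J0) !mul1r invfM mulrCA divff ?mulr1 //.
    by rewrite pnatr_eq0 gtn_eqF.
  move=> M [coM /= [<- <-]]; rewrite /zeta_O2_term.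
  have [_ ->] := cotorsion_index finA coM.
  have [nz1 nz2] := cotorsion_nonzero coM.
  by rewrite natcpowM ?ideal_norm_gt0 // /zeta_ideal_term !mul1r invfM.
have h3 : has_csum nz (fun I => l1 * zeta_ideal_term s I) l.
  apply: (has_csum_fiber (p := fst) _ hX) => [[I J] []//|I nzI].
  have -> : (nz `*` nz) `&` fst @^-1` [set I] = (fun J => (I, J)) @` nz.
    by apply/seteqP; split=> [[I' J] [[/= ? ?] ->]|_ [J ? <-]] //; exists J.
  apply: has_csum_image; first by move=> J J' _ _ [].
  by rewrite mulrC; exact: has_csumZ.
exact: has_csum_uniq h3 (has_csumZ _ h2).
Qed.

Lemma has_csum_primitive s : 2 < complex.Re s ->
  exists l, has_csum (@primitive A) (@zeta_O2_term R A s) l.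
Proof.
move=> s2; have primS : @primitive A `<=` @cotorsion_submodules A by move=> M [].
apply: has_csum_bounded (sum_boundedS primS (sum_bounded_O2 s2)) _ => M [coM _].
by rewrite norm_inv_natcpow ?cotorsion_index_gt0.
Qed.

Lemma zeta_O2_content s l lp l2 :
  has_csum (@cotorsion_submodules A) (@zeta_O2_term R A s) l ->
  has_csum (@primitive A) (@zeta_O2_term R A s) lp ->
  has_csum (@nonzero_ideals A) (zeta_ideal_term (2 * s)) l2 ->
  l = l2 * lp.
Proof.
move=> hl hp h2.
have h3 : has_csum (@nonzero_ideals A) (fun I => lp * zeta_ideal_term (2 * s) I) l.
  apply: (has_csum_fiber (p := @content A) _ hl) => [M coM|I nzI].
    exact: content_nonzero.
  rewrite -(smul_primitive_fiber domA finA intA nzI).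
  apply: has_csum_image; first exact: (smul_primitive_inj domA finA intA nzI).
  rewrite mulrC; apply: has_csum_ext (has_csumZ _ hp) => M [coM _] /=.
  rewrite /zeta_O2_term (module_index_smul2 domA finA intA nzI coM).
  have I0 := ideal_norm_gt0 nzI; have M0 := cotorsion_index_gt0 coM.
  rewrite natcpowM ?muln_gt0 ?I0 // natcpowM // -natcpow2.
  by rewrite /zeta_ideal_term !mul1r (invfM (natcpow (ideal_norm I) (2 * s))).
by rewrite mulrC; exact: has_csum_uniq h3 (has_csumZ _ h2).
Qed.

Lemma has_csum_PF1 s l : 2 < complex.Re s ->
  has_csum (@primitive A) (@zeta_O2_term R A s) l ->
  has_csum (@nonzero_ideals A) (zeta_PF1_term s) l.
Proof.
move=> s2 hl; apply: (has_csum_fiber (p := @annihilator A) _ hl) => [M [coM _]|J nzJ].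
  exact: annihilator_nonzero.
have [EF Finj Find] := PF1_fiber domA finA nzJ.
set F := _ `&` _ in EF Finj Find *.
have J0 := ideal_norm_gt0 nzJ.
have FS : F `<=` @cotorsion_submodules A by move=> M [[]].
(* Finiteness must precede the count by [set_card]. All members have index N(J), and a convergent
   sum has finitely many terms of a given positive size. *)
have finF : finite_set F.
  apply: (@sum_bounded_finite R _ _ ((ideal_norm J)%:R `^ (- complex.Re s))).
    by rewrite powR_gt0 // ltr0n.
  apply: sum_bounded_le (sum_boundedS FS (sum_bounded_O2 s2)) => M FM.
  by rewrite Find.
have <- : \sum_(M \in F) zeta_O2_term s M = zeta_PF1_term s J.
  rewrite (fsum_const (c := 1 / natcpow (ideal_norm J) s)) //.
    have [_ cardE] := set_card_inj finF Finj.
    by rewrite /zeta_PF1_term EF cardE mul1r.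
  by move=> M /Find; rewrite /zeta_O2_term => ->.
exact: has_csum_finite.
Qed.

End ZetaFunctions.

Theorem theorem5p2 (R : realType) (K : fieldExtType rat) (s : R[i])
    (hs : 2 < complex.Re s) :
  let OK := ring_of_integers K in
  [/\ zeta_O2_cvg OK s,
      zeta_ideal_cvg OK (s - 1), zeta_ideal_cvg OK s,
      zeta_ideal_cvg OK (2 * s) & zeta_PF1_cvg OK s] /\
  zeta_O2 OK s = zeta_ideal OK (s - 1) * zeta_ideal OK s /\
  zeta_O2 OK s = zeta_ideal OK (2 * s) * zeta_PF1 OK s.
Proof.
move=> OK.
have dom := @ring_of_integers_torsion_free K.
have fin := @ring_of_integers_fin_index K.
have int := @ring_of_integers_closed K.
have rk := @ring_of_integers_rank K.
have [l hl] := has_csum_O2 dom fin int rk hs.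
have [lp hp] := has_csum_primitive dom fin int rk hs.
have [l1 h1] : exists l1, has_csum (@nonzero_ideals OK) (zeta_ideal_term (s - 1)) l1.
  by apply: (has_csum_zeta dom fin int rk); case: (s) hs => a b /=; lra.
have [l0 h0] : exists l0, has_csum (@nonzero_ideals OK) (zeta_ideal_term s) l0.
  by apply: (has_csum_zeta dom fin int rk); lra.
have [l2 h2] : exists l2, has_csum (@nonzero_ideals OK) (zeta_ideal_term (2 * s)) l2.
  apply: (has_csum_zeta dom fin int rk); rewrite mulrDl mul1r.
  by case: (s) hs => a b /=; lra.
have hF := has_csum_PF1 dom fin int rk hs hp.
have [cl El] := has_csum_csum hl; have [c1 E1] := has_csum_csum h1.
have [c0 E0] := has_csum_csum h0; have [c2 E2] := has_csum_csum h2.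
have [cF EF] := has_csum_csum hF.
split; first by split; [exact: cl|exact: c1|exact: c0|exact: c2|exact: cF].
rewrite /zeta_O2 /zeta_ideal /zeta_PF1 El E1 E0 E2 EF; split.
  exact: (zeta_O2_product dom fin int hs hl h1 h0).
exact: (zeta_O2_content dom fin int hl hp h2).
Qed.
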